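(* For every fixed $0<R\le 1/3$ and every holomorphic function $f(z)=\sum_{n=0}^\infty a_nz^n$ on $\mathbb{D}$ such that $|f(z)|\le 1$ for every $z\in\mathbb{D}$, we have $$\sum_{n=0}^\infty|a_n|r^n+\Lambda(R)\left(\frac{S_r(f)}{\pi-S_r(f)}\right)\le 1\qquad\text{for every } 0\le r\le R,$$ where the sharp constant $\Lambda(R)$ is given by $$\Lambda(R)=\inf_{a\in[0,1)}\frac{1-R^2}{R^2}\cdot\frac{1-a^4R^2}{(1-a)(1+a)^2}\cdot\frac{1-R(1+2a)}{1-aR}.$$
   Context: $\mathbb{D}$ is the open unit disc of $\mathbb{C}$ and $\mathcal{B}$ is the class of all holomorphic functions $f\colon\mathbb{D}\to\mathbb{C}$, $f(z)=\sum_{n=0}^\infty a_n z^n$, with $|f(z)|\le 1$ for every $z\in\mathbb{D}$. For $f\in\mathcal{B}$ and $0\le r\le 1/3$, $$S_r(f)=\int_{r\mathbb{D}}|f'(w)|^2\,\mathrm{d}A(w)=\pi\sum_{n=1}^\infty n|a_n|^2r^{2n},$$ where $\mathrm{d}A$ is Lebesgue area measure. The sharp constant is the largest constant for which the inequality holds for all functions in the class and all radii up to $R$: $$\Lambda(R)=\sup\Big\{\lambda\ge 0:\ \sum_{n=0}^\infty|a_n|r^n+\lambda\,\frac{S_r(f)}{\pi-S_r(f)}\le 1 \text{ for all } f=\sum_{n}a_nz^n\in\mathcal{B} \text{ and all } 0\le r\le R\Big\}.$$ The claim thus asserts that this supremum equals the displayed infimum and that the inequality holds with this constant. *)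

(* Defs.v *)
From HB Require Import structures.
From mathcomp Require Import all_boot all_order all_algebra.
From mathcomp Require Import complex.
From mathcomp Require Import all_classical all_reals all_analysis.

Set Implicit Arguments.
Unset Strict Implicit.
Unset Printing Implicit Defensive.

Import Order.TTheory GRing.Theory Num.Theory.
Import numFieldNormedType.Exports.

Local Open Scope classical_set_scope.
Local Open Scope ring_scope.
Local Open Scope complex_scope.

Definition cmod (R : realType) (z : R[i]) : R := ComplexField.Normc.normc z.

(* The regular algebra R[i]^o carries the topology of the modulus, for which
   [derivable] and [derive1] are complex differentiability and the complex
   derivative. *)
Definition holomorphic_on_disc (R : realType) (f : R[i]^o -> R[i]^o) : Prop :=
  forall z : R[i]^o, cmod z < 1 -> derivable f z 1.

Definition has_power_series (R : realType)
    (f : R[i]^o -> R[i]^o) (a : nat -> R[i]^o) : Prop :=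
  forall z : R[i]^o, cmod z < 1 ->
    [series a n * z ^+ n]_n @ \oo --> f z.

(* The class B, each function being given together with its Taylor
   coefficients. *)
Definition classB (R : realType)
    (f : R[i]^o -> R[i]^o) (a : nat -> R[i]^o) : Prop :=
  [/\ holomorphic_on_disc f,
      has_power_series f a &
      forall z : R[i]^o, cmod z < 1 -> cmod (f z) <= 1].

(* The plane is identified with R * R through (x, y) |-> x + i y, and dA is
   the product Lebesgue measure.  [Rintegral] takes the finite part of the
   integral, which is finite for f in class B and r < 1. *)
Definition disc_area (R : realType) (f : R[i]^o -> R[i]^o) (r : R) : R :=
  Rintegral (@lebesgue_measure R \x @lebesgue_measure R)%E
    [set p : R * R | cmod (p.1 +i* p.2) < r]
    (fun p : R * R => cmod (derive1 f (p.1 +i* p.2)) ^+ 2).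

(* The series of moduli is taken in the extended reals, so that the inequality
   includes its convergence. *)
Definition bohr_ineq (R : realType) (f : R[i]^o -> R[i]^o) (a : nat -> R[i]^o)
    (r lam : R) : Prop :=
  (\sum_(0 <= n <oo) (cmod (a n) * r ^+ n)%:E
     + (lam * (disc_area f r / (pi - disc_area f r)))%:E <= 1)%E.

(* [sup] is a genuine supremum: by Bohr's inequality 0 belongs to the set when
   rho <= 1/3, and f = id bounds it as soon as 0 < rho. *)
Definition sharp_const (R : realType) (rho : R) : R :=
  sup [set lam : R | 0 <= lam /\
    forall (f : R[i]^o -> R[i]^o) (a : nat -> R[i]^o), classB f a ->
    forall r : R, 0 <= r <= rho -> bohr_ineq f a r lam].

Definition sharp_formula (R : realType) (rho a : R) : R :=
  (1 - rho ^+ 2) / rho ^+ 2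
  * ((1 - a ^+ 4 * rho ^+ 2) / ((1 - a) * (1 + a) ^+ 2))
  * ((1 - rho * (1 + 2 * a)) / (1 - a * rho)).

(* Main.v *)
Require Import Defs.
From HB Require Import structures.
From mathcomp Require Import all_boot all_order all_algebra.
From mathcomp Require Import complex.
From mathcomp Require Import all_classical all_reals all_analysis.
From mathcomp Require Import measurable_realfun ring lra.

(* Everything comes from Parseval's identity on discs,
   [int_{|z|<s} |p|^2 = pi sum |p_k|^2 s^(2k+2)/(k+1)], which holds because a
   rotation w with w^(j-k) = -1 preserves the plane measure and flips the sign
   of the cross term of z^j and z^k.

   Applied to z^M f(z) (1 + c z^n), with M -> oo and then s -> 1, and with the
   best c, it gives [|a_n|^2 <= (1 - |a_0|^2) (1 - sum_{k<n} |a_k|^2)].  Hence,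
   with A = |a_0|, the partial sums of [|a_k|^2], k >= 1, are at most those of
   the Moebius map (A - z)/(1 - A z), and by Abel summation the same holds after
   weighting by a nonincreasing sequence.  The weights k r^(2k) bound the area,
   and for r <= A the weights (r/A)^k bound [sum |a_k| r^k]: in this range the
   Moebius maps are extremal, and the inequality reduces to the definition of
   the constant, since its formula is antitone in the radius.  For A < r
   Cauchy-Schwarz suffices, with the constant tested against the Moebius map of
   parameter r. *)

Import Order.TTheory GRing.Theory Num.Theory.
Import numFieldNormedType.Exports.
Local Open Scope classical_set_scope.
Local Open Scope ring_scope.

(** * Rotation invariance of the plane measure *)

(** The estimate |a_n| <= 1 - |a_0|^2 is too weak here: it loses the decay A^k of the Moebius
    coefficients, and a sharp constant tolerates no loss at the extremal maps. The decay is
    recovered only in the mean, for partial sums of squares. Plain Parseval gives sum |a_k|^2 <= 1;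
    the factor 1 + c z^n is what brings in A, since it shifts the n-th coefficient by c a_0 at the
    price of |c|^2 on the right. Circle means are replaced by area integrals weighted by |z|^(2M)
    because the same identity on discs then also evaluates S_r. Passing from squares to moduli uses
    2 |a_k| b_k <= |a_k|^2 + b_k^2, where b_k is the modulus of the Moebius coefficient. The
    resulting weights r^k / b_k are nonincreasing only if r <= A, which forces the case split. The
    Cauchy-Schwarz bound used for A < r is tuned to agree with the Moebius value at A = r. *)

Lemma lebesgue_measure_translate (R : realType) (c : R) (A : set R) :
  measurable A ->
  lebesgue_measure ((fun y => y + c) @^-1` A) = lebesgue_measure A.
Proof.
have mT : measurable_fun [set: measurableTypeR R]
    (fun y : measurableTypeR R => (y + c : measurableTypeR R)).
  exact: measurable_funD.
pose mu : {measure set measurableTypeR R -> \bar R} :=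
  pushforward lebesgue_measure
    (fun y : measurableTypeR R => (y + c : measurableTypeR R)).
move=> mA; apply/esym; apply: (@lebesgue_measure_unique R (mu mT)) => //.
move=> _ [[a b]] _ <-; rewrite /mu /= /pushforward /=.
have -> : (fun y => y + c) @^-1` `]a, b]%classic = `](a - c), (b - c)]%classic.
  by apply/seteqP; split => y /=; rewrite !in_itv /= ltrBlDr lerBrDr.
by rewrite !lebesgue_measure_itv /= !lte_fin ltrD2r -!EFinB opprB addrA subrK.
Qed.

Local Notation plane_measure R := (@lebesgue_measure R \x @lebesgue_measure
  R)%E.

Definition preserves_plane_measure (R : realType) (T : R * R -> R * R) :=
  measurable_fun setT T /\
  forall A : set (R * R), measurable A ->
    plane_measure R (T @^-1` A) = plane_measure R A.

Lemma preserves_plane_measure_comp (R : realType) (S T : R * R -> R * R) :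
  preserves_plane_measure R S -> preserves_plane_measure R T ->
  preserves_plane_measure R (S \o T).
Proof.
move=> [mS HS] [mT HT]; split; first exact: measurableT_comp.
move=> A mA; rewrite comp_preimage HT ?HS //.
by rewrite -[X in measurable X]setTI; exact: mS.
Qed.

(** On the vertical line of abscissa x the shear is the translation by t x, and the product measure
    integrates the measures of vertical sections. *)
Lemma preserves_vertical_shear (R : realType) (t : R) :
  preserves_plane_measure R (fun p => (p.1, p.2 + t * p.1)).
Proof.
split.
  apply: measurable_fun_pair => //.
  by apply: measurable_funD => //; exact: measurable_funM.
move=> A mA; apply: eq_integral => x _ /=.
rewrite -(@lebesgue_measure_translate _ (t * x) (xsection A x)).
  by congr lebesgue_measure; apply/seteqP; split => y;
    rewrite /xsection /= !inE.
exact: measurable_xsection.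
Qed.

Lemma preserves_horizontal_shear (R : realType) (t : R) :
  preserves_plane_measure R (fun p => (p.1 + t * p.2, p.2)).
Proof.
have mT : measurable_fun [set: R * R] (fun p => (p.1 + t * p.2, p.2)).
  apply: measurable_fun_pair => //.
  by apply: measurable_funD => //; exact: measurable_funM.
split => // A mA.
(* The shear translates horizontal sections, so the product measure is first rewritten, by
   uniqueness, as the iterated integral in the other order. *)
have E (B : set (R * R)) : measurable B -> plane_measure R B =
    (@lebesgue_measure R \x^ @lebesgue_measure R)%E B.
  move=> mB; apply: (@product_measure_unique _ _ _ _ _ lebesgue_measure
    lebesgue_measure (lebesgue_measure \x^ lebesgue_measure)%E) => // *.
  exact: product_measure2E.
rewrite !E //; last by rewrite -[X in measurable X]setTI; exact: mT.
apply: eq_integral => y _ /=.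
rewrite -(@lebesgue_measure_translate _ (t * y) (ysection A y)).
  by congr lebesgue_measure; apply/seteqP; split => x;
    rewrite /ysection /= !inE.
exact: measurable_ysection.
Qed.

(* A rotation by t is the product of three shears of slopes -tan(t/2), sin t
   and -tan(t/2), except when t = pi, which is the square of t = pi/2. *)
Lemma preserves_rotation (R : realType) (c s : R) : c ^+ 2 + s ^+ 2 = 1 ->
  preserves_plane_measure R (fun p => (c * p.1 - s * p.2, s * p.1 + c * p.2)).
Proof.
have H0 (c' s' : R) : s' != 0 -> c' ^+ 2 + s' ^+ 2 = 1 ->
    preserves_plane_measure R
      (fun p => (c' * p.1 - s' * p.2, s' * p.1 + c' * p.2)).
  move=> s0 cs.
  have [t ts tc] : exists2 t, c' = 1 + t * s' & - s' = t * (1 + c').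
    exists ((c' - 1) / s'); first by rewrite mulfVK // addrC subrK.
    apply: (mulIf s0); rewrite mulrAC mulfVK // mulNr -expr2.
    by rewrite -[s' ^+ 2](addKr (c' ^+ 2)) cs; ring.
  have := preserves_plane_measure_comp _ _ _ (preserves_horizontal_shear _ t)
   (preserves_plane_measure_comp _ _ _ (preserves_vertical_shear _ s')
     (preserves_horizontal_shear _ t)).
  congr (preserves_plane_measure R); apply/funext => -[x y] /=; congr (_, _).
    rewrite -[c' * x - s' * y]/(c' * x + - (s' * y)) -[- (s' * y)]mulNr tc ts.
    by ring.
  by rewrite ts; ring.
move=> cs; have [s0|] := eqVneq s 0; last by move=> s0; exact: H0.
have /orP[/eqP c1|/eqP c1] : (c == 1) || (c == -1).
  by rewrite -sqrf_eq1 -cs s0 expr0n addr0.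
  split; first by apply: measurable_fun_pair;
    [apply: measurable_funB|apply: measurable_funD] => //;
    exact: measurable_funM.
  move=> A _; congr (plane_measure R _); apply/seteqP.
  by rewrite s0 c1; split=> -[x y] /=; rewrite !mul1r !mul0r subr0 add0r.
have H1 : preserves_plane_measure R (fun p => (0 * p.1 - 1 * p.2, 1 * p.1 + 0
  * p.2)).
  by apply: H0; rewrite ?oner_eq0 // expr0n expr1n add0r.
have := preserves_plane_measure_comp _ _ _ H1 H1.
congr (preserves_plane_measure R); apply/funext => -[x y] /=.
by rewrite s0 c1; congr (_, _); ring.
Qed.

(** * Discs *)

Local Notation pt q := (q.1 +i* q.2)%C.

Definition disc (R : realType) (s : R) : set (R * R) :=
  [set p : R * R | cmod (pt p) < s].

Lemma discE (R : realType) (s : R) : 0 < s ->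
  disc R s = [set p | p.1 ^+ 2 + p.2 ^+ 2 < s ^+ 2].
Proof.
move=> s0; apply/funext => -[x y]; apply/propext; rewrite /disc /cmod /=.
by rewrite -{1}(gtr0_norm s0) -sqrtr_sqr ltr_sqrt ?exprn_gt0.
Qed.

Lemma measurable_disc (R : realType) (s : R) :
  measurable (disc R s : set (measurableTypeR R * measurableTypeR R)).
Proof.
have [s0|s0] := ltP 0 s; last first.
  rewrite (_ : disc R s = set0) //; apply/seteqP; split => // -[x y].
  by rewrite /disc /cmod /= => /lt_le_trans/(_ s0); rewrite ltNge sqrtr_ge0.
rewrite discE //.
have mq : measurable_fun [set: R * R] (fun p => p.1 ^+ 2 + p.2 ^+ 2).
  by apply: measurable_funD; exact: measurable_funX.
rewrite (_ : [set p | _] =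
    (fun p : R * R => p.1 ^+ 2 + p.2 ^+ 2) @^-1` `]-oo, (s ^+ 2)[%classic).
  by rewrite -[X in measurable X]setTI; apply: mq.
by apply/seteqP; split => p /=; rewrite in_itv.
Qed.

(** The substitution x = s sin t turns the integrand into 2 s^2 cos^2 t, with antiderivative [H].
    The integrand is the length of the vertical section of the disc at x. *)
Lemma integral_half_circle (R : realType) (s : R) : 0 < s ->
  (\int[lebesgue_measure]_(x in `[(- s)%R, s])
     (2 * Num.sqrt (s ^+ 2 - x ^+ 2))%:E = (pi * s ^+ 2)%:E)%E.
Proof.
move=> s0.
have pi2 : 0 < pi / 2 :> R by rewrite divr_gt0 // pi_gt0.
have pi2N : - (pi / 2) < pi / 2 :> R by rewrite gtrN.
pose F := fun t : R => s * sin t.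
have dF (t : R) : is_derive t 1 F (s * cos t).
  exact: (@is_deriveZ _ _ _ (@sin R) s).
have F1 : derive1 F = fun t => s * cos t.
  by apply/funext => t; rewrite derive1E; apply: derive_val.
pose H := fun t : R => s ^+ 2 * (t + sin t * cos t).
have dH (t : R) : is_derive t 1 H (2 * (s * cos t) * (s * cos t)).
  rewrite (_ : H = s ^+ 2 \*: (id + (@sin R) * (@cos R))); last exact/funext.
  apply: is_derive_eq.
  rewrite -![_ *: _]/(_ * _).
  have := cos2Dsin2 t; move: (cos t) (sin t) => c d E.
  have -> : 2 * (s * c) * (s * c) = s ^+ 2 * (1 + c ^+ 2 - d ^+ 2).
    by rewrite (_ : d ^+ 2 = 1 - c ^+ 2); [ring|lra].
  by ring.
have cD (f f' : R -> R) : (forall t : R, is_derive t (1 : R) f (f' t)) ->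
  continuous f.
  move=> df t; apply: differentiable_continuous; apply/derivable1_diffP.
  by have [] := df t.
have FLR (f f' : R -> R) a b : (forall t : R, is_derive t (1 : R) f (f' t)) ->
    derivable_oo_LRcontinuous f a b.
  move=> df; have cf := cD f f' df; split.
  - by move=> t _; have [] := df t.
  - exact/cvg_at_right_filter/cf.
  - exact/cvg_at_left_filter/cf.
have cc : continuous (fun t : R => s * cos t).
  by move=> t; apply: cvgMr; exact: continuous_cos.
have FN : F (- (pi / 2)) = - s by rewrite /F sinN sin_pihalf mulrN1.
have FP : F (pi / 2) = s by rewrite /F sin_pihalf mulr1.
rewrite -{1}FN -{1}FP integration_by_substitution_increasing.
- rewrite F1.
  transitivity (\int[lebesgue_measure]_(x in `[(- (pi / 2))%R, (pi / 2)%R])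
     (2 * (s * cos x) * (s * cos x))%:E)%E.
    apply: eq_integral => t; rewrite inE /= in_itv /= => ht; congr EFin.
    rewrite /F /= -[LHS]/(2 * Num.sqrt (s ^+ 2 - (s * sin t) ^+ 2) * (s * cos
      t)).
    congr (_ * _ * _).
    rewrite exprMn -[X in X - _]mulr1 -mulrBr -cos2sin2 -exprMn sqrtr_sqr.
    by rewrite ger0_norm // mulr_ge0 ?(ltW s0) // cos_ge0_pihalf.
  rewrite (@continuous_FTC2 _ _ H) //.
  + rewrite -EFinB /H cosN cos_pihalf !mulr0 !addr0; congr EFin.
    by field.
  + apply: continuous_subspaceT => t; apply: cvgM; last exact: cc.
    by apply: cvgMr; exact: cc.
  + exact: (FLR _ _ _ _ dH).
  + by move=> t _; rewrite derive1E; apply: derive_val.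
- exact: ltW.
- by move=> x y hx hy xy; rewrite /F ltr_pM2l // ltr_sin.
- by move=> t _; rewrite F1; exact: cc.
- rewrite F1; apply/cvg_ex; exists (s * cos (- (pi / 2))).
  exact/cvg_at_right_filter/cc.
- rewrite F1; apply/cvg_ex; exists (s * cos (pi / 2)).
  exact/cvg_at_left_filter/cc.
- exact: (FLR _ _ _ _ dF).
- apply: continuous_subspaceT => x; apply: cvgMr.
  apply: (continuous_comp (f := fun y : R => s ^+ 2 - y ^+ 2)).
    by apply: cvgB; [exact: cvg_cst|exact: exprn_continuous].
  exact: sqrt_continuous.
Qed.

Lemma plane_measure_disc (R : realType) (s : R) : 0 <= s ->
  plane_measure R (disc R s) = (pi * s ^+ 2)%:E.
Proof.
rewrite le_eqVlt => /predU1P[<-|s0].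
  rewrite (_ : disc R 0 = set0) ?measure0 ?expr0n ?mulr0 //.
  apply/seteqP; split => // -[x y].
  by rewrite /disc /cmod /= ltNge sqrtr_ge0.
rewrite -integral_half_circle // discE // integral_mkcond.
apply: eq_integral => x _ /=; rewrite patchE.
set q := s ^+ 2 - x ^+ 2.
have -> : xsection [set p : R * R | p.1 ^+ 2 + p.2 ^+ 2 < s ^+ 2] x =
    `](- Num.sqrt q), (Num.sqrt q)[%classic.
  apply/seteqP; split => y; rewrite /xsection /= inE /= in_itv /= -ltr_norml.
    rewrite -ltrBrDl -/q => yq.
    by rewrite -(sqrtr_sqr y) ltr_sqrt // (le_lt_trans _ yq) // sqr_ge0.
  rewrite -(sqrtr_sqr y) -ltrBrDl -/q => yq.
  have q0 : 0 < q by rewrite -sqrtr_gt0 (le_lt_trans _ yq) // sqrtr_ge0.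
  by rewrite ltr_sqrt in yq.
rewrite lebesgue_measure_itv /= lte_fin.
rewrite (_ : (- Num.sqrt q < Num.sqrt q) = (0 < Num.sqrt q)); last first.
  by apply/idP/idP; lra.
case: ifPn => [q0|].
  rewrite mem_set; first by rewrite -EFinB opprK mulr_natl mulr2n.
  rewrite /= in_itv /= -ler_norml ltW // -ltr_sqr ?nnegrE ?normr_ge0 ?(ltW s0)
    //.
  by rewrite real_normK ?num_real // -subr_gt0 -sqrtr_gt0.
(* [Num.sqrt] sends a nonpositive [q] to 0, so this case covers |x| >= s, including the two
   endpoints of the closed interval. *)
rewrite -leNgt => q0; have -> : Num.sqrt q = 0.
  by apply/eqP; rewrite eq_le q0 sqrtr_ge0.
by rewrite mulr0 if_same.
Qed.

(** A derivative-free form of: a zero derivative implies constancy. Cutting [0, u] into N + 1 equal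
    pieces, the right-hand sides telescope to (u / (N + 1)) (G u - G 0), which is arbitrarily
    small. *)
Lemma eq_of_small_increments (R : realType) (F G : R -> R) (u : R) :
  0 <= u ->
  (forall t v, 0 <= t -> t <= v -> `|F v - F t| <= (v - t) * (G v - G t)) ->
  F u = F 0.
Proof.
move=> u0 FG; apply/eqP; rewrite -subr_eq0 -normr_le0.
apply/ler_addgt0Pr => e e0; rewrite add0r.
have [N] : exists N : nat, u * (G u - G 0) / e < N.+1%:R.
  exists (Num.truncn (u * (G u - G 0) / e)); exact: truncnS_gt.
rewrite ltr_pdivrMr // => Ne.
set d : R := u / N.+1%:R.
have N0 : 0 < N.+1%:R :> R by rewrite ltr0n.
have d0 : 0 <= d by rewrite divr_ge0 // ltW.
have H i : `|F (i%:R * d) - F 0| <= d * (G (i%:R * d) - G 0).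
  elim: i => [|i IH]; first by rewrite mul0r !subrr normr0 mulr0.
  have id0 : 0 <= i%:R * d by rewrite mulr_ge0.
  have E : i.+1%:R * d = i%:R * d + d by rewrite -natr1 mulrDl mul1r.
  have idd : i%:R * d <= i.+1%:R * d by rewrite E lerDl.
  have := FG _ _ id0 idd.
  rewrite {2}E addrAC subrr add0r => H1.
  have := ler_normD (F (i.+1%:R * d) - F (i%:R * d)) (F (i%:R * d) - F 0).
  by rewrite addrA subrK; lra.
have := H N.+1; have -> : N.+1%:R * d = u by rewrite mulrC divfK // gt_eqF.
move=> /le_trans; apply.
by rewrite /d mulrAC ler_pdivrMr // [leRHS]mulrC ltW.
Qed.

Lemma subrX_bounds (R : realFieldType) (t u : R) (k : nat) : 0 <= t -> t <= u ->
  k.+1%:R * t ^+ k * (u - t) <= u ^+ k.+1 - t ^+ k.+1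
    <= k.+1%:R * u ^+ k * (u - t).
Proof.
move=> t0 tu; have u0 := le_trans t0 tu;
  have ut : 0 <= u - t by rewrite subr_ge0.
rewrite subrXX [(u - t) * _]mulrC.
have S (x : R) : k.+1%:R * x ^+ k = \sum_(i < k.+1) x ^+ k.
  by rewrite sumr_const card_ord mulr_natl.
rewrite !S; apply/andP; split; apply: ler_wpM2r => //;
  apply: ler_sum => i _ /=.
  rewrite -[in leLHS](subnK (leq_ord i)) exprD.
  by rewrite ler_wpM2r ?exprn_ge0 // lerXn2r // nnegrE.
rewrite -[in leRHS](subnK (leq_ord i)) exprD.
by rewrite ler_wpM2l ?exprn_ge0 // lerXn2r // nnegrE.
Qed.

Lemma sandwich_dist (R : realDomainType) (a b v w : R) :
  a <= v -> v <= b -> a <= w -> w <= b -> `|v - w| <= b - a.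
Proof. by move=> av vb aw wb; rewrite ler_norml; apply/andP; split; lra. Qed.

Lemma measurable_sqr_radius (R : realType) (k : nat) :
  measurable_fun [set: measurableTypeR R * measurableTypeR R]
    (fun p => ((p.1 ^+ 2 + p.2 ^+ 2) ^+ k)%:E).
Proof.
apply/measurable_EFinP; apply: measurable_funX.
by apply: measurable_funD; exact: measurable_funX.
Qed.

(** This replaces polar coordinates. With the squared radius as variable, the annulus between t and
    u has area pi (u - t), and the integrand lies between t^k and u^k on it. The increment of pi
    u^(k+1) / (k+1) satisfies the same two bounds, so the difference [F] has small increments and
    stays equal to F 0 = 0. *)
Lemma integral_disc_radius (R : realType) (s : R) (k : nat) : 0 <= s ->
  (\int[plane_measure R]_(p in disc R s)
     ((p.1 ^+ 2 + p.2 ^+ 2) ^+ k)%:E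
   = (pi * s ^+ (k.+1).*2 / k.+1%:R)%:E)%E.
Proof.
move=> s0; set h := fun p : R * R => ((p.1 ^+ 2 + p.2 ^+ 2) ^+ k)%:E.
have mh (D : set (measurableTypeR R * measurableTypeR R)) : measurable_fun D h.
  by apply: measurable_funTS; exact: measurable_sqr_radius.
have h0 p : (0 <= h p)%E by rewrite lee_fin exprn_ge0 // addr_ge0 // sqr_ge0.
have mdisc := @measurable_disc R.
have inD (u : R) p : 0 <= u -> disc R (Num.sqrt u) p -> p.1 ^+ 2 + p.2 ^+ 2 < u.
  rewrite le_eqVlt => /predU1P[<-|u0].
    by rewrite sqrtr0 /disc /cmod /= ltNge sqrtr_ge0.
  by rewrite discE ?sqrtr_gt0 //= sqr_sqrtr // ltW.
have outD (u : R) p : 0 <= u -> ~ disc R (Num.sqrt u) p ->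
    u <= p.1 ^+ 2 + p.2 ^+ 2.
  rewrite le_eqVlt => /predU1P[<-|u0]; first by rewrite addr_ge0 // sqr_ge0.
  by rewrite discE ?sqrtr_gt0 //= sqr_sqrtr ?(ltW u0) // => /negP;
    rewrite -leNgt.
have DD (t u : R) : t <= u -> disc R (Num.sqrt t) `<=` disc R (Num.sqrt u).
  by move=> tu p /lt_le_trans; apply; rewrite ler_wsqrtr.
pose I u := (\int[plane_measure R]_(p in disc R (Num.sqrt u)) h p)%E.
have annulus (t u : R) : 0 <= t -> t <= u ->
    exists2 v : R, I u = (I t + v%:E)%E &
      t ^+ k * (pi * (u - t)) <= v <= u ^+ k * (pi * (u - t)).
  move=> t0 tu; have u0 := le_trans t0 tu.
  set A := disc R (Num.sqrt u) `\` disc R (Num.sqrt t).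
  have mA : measurable (A : set (measurableTypeR R * measurableTypeR R)).
    exact: measurableD.
  have muA : plane_measure R A = (pi * (u - t))%:E.
    have EI : disc R (Num.sqrt u) `&` disc R (Num.sqrt t) = disc R (Num.sqrt t).
      exact/setIidr/DD.
    have Et := plane_measure_disc R _ (sqrtr_ge0 t).
    have Eu := plane_measure_disc R _ (sqrtr_ge0 u).
    rewrite /A measureD //; last by rewrite [ltLHS]Eu ltry.
    by rewrite EI [X in (X - _)%E]Eu [X in (_ - X)%E]Et !sqr_sqrtr // -EFinB
      -mulrBr.
  have IA : I u = (I t + \int[plane_measure R]_(p in A) h p)%E.
    rewrite /I -ge0_integral_setU //; first by rewrite setDUK //; exact: DD.
    by apply/disj_set2P; rewrite /A setDE setIC -setIA setICl setI0.
  have lo : ((t ^+ k * (pi * (u - t)))%:E <=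
      \int[plane_measure R]_(p in A) h p)%E.
    rewrite EFinM -muA -integral_cst //; apply: ge0_le_integral => //.
      by move=> p _; rewrite lee_fin exprn_ge0.
    move=> p [_ /(outD _ _ t0) tp]; rewrite lee_fin lerXn2r ?nnegrE //.
    exact: le_trans tp.
  have hi : (\int[plane_measure R]_(p in A) h p <=
      (u ^+ k * (pi * (u - t)))%:E)%E.
    rewrite EFinM -muA -integral_cst //; apply: ge0_le_integral => //.
    move=> p [/(inD _ _ u0) /ltW up _]; rewrite lee_fin lerXn2r ?nnegrE //.
    by rewrite addr_ge0 // sqr_ge0.
  exists (fine (\int[plane_measure R]_(p in A) h p)%E).
    rewrite fineK // ge0_fin_numE ?integral_ge0 //.
    by rewrite (le_lt_trans hi) // ltry.
  rewrite -!lee_fin fineK ?lo ?hi // ge0_fin_numE ?integral_ge0 //.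
  by rewrite (le_lt_trans hi) // ltry.
have I0 : I 0 = 0%E.
  rewrite /I (_ : disc R _ = set0) ?integral_set0 //.
  by apply/seteqP; split => // p; rewrite sqrtr0 /disc /cmod /= ltNge sqrtr_ge0.
have Ifin u : 0 <= u -> I u \is a fin_num.
  by move=> /(annulus 0 u (lexx _))[v -> _]; rewrite I0 add0e.
pose F u := fine (I u) - pi * u ^+ k.+1 / k.+1%:R.
have := @eq_of_small_increments R F (fun u => pi * u ^+ k) (s ^+ 2)
  (sqr_ge0 s).
have k0 : k.+1%:R != 0 :> R by rewrite pnatr_eq0.
have F0 : F 0 = 0 by rewrite /F I0 expr0n /= mulr0 mul0r subr0.
rewrite F0 => H; have {H} : F (s ^+ 2) = 0; [apply: H|].
  move=> t u t0 tu; have [v Iu /andP[v1 v2]] := annulus t u t0 tu.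
  have /andP[w1 w2] := @subrX_bounds R t u k t0 tu.
  have pi0 := @pi_ge0 R.
  rewrite /F Iu fineD ?Ifin //=.
  set X := u ^+ k.+1 - t ^+ k.+1 in w1 w2.
  have -> : fine (I t) + v - pi * u ^+ k.+1 / k.+1%:R -
    (fine (I t) - pi * t ^+ k.+1 / k.+1%:R) = v - pi * (X / k.+1%:R).
    by rewrite /X; field.
  have x1 : t ^+ k * (u - t) <= X / k.+1%:R.
    by rewrite ler_pdivlMr ?ltr0n // mulrC mulrA.
  have x2 : X / k.+1%:R <= u ^+ k * (u - t).
    by rewrite ler_pdivrMr ?ltr0n // [leRHS]mulrC mulrA.
  have y1 := ler_wpM2l pi0 x1; have y2 := ler_wpM2l pi0 x2.
  rewrite (mulrCA pi (t ^+ k)) in y1; rewrite (mulrCA pi (u ^+ k)) in y2.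
  have -> : (u - t) * (pi * u ^+ k - pi * t ^+ k) =
    u ^+ k * (pi * (u - t)) - t ^+ k * (pi * (u - t)) by ring.
  exact: (sandwich_dist _ _ _ _ _ v1 v2 y1 y2).
rewrite /F /I sqrtr_sqr ger0_norm // => /eqP; rewrite subr_eq0 => /eqP E.
rewrite -[LHS]fineK ?E; last by have := Ifin _ (sqr_ge0 s);
  rewrite /I sqrtr_sqr ger0_norm.
by rewrite -muln2 mulnC exprM.
Qed.

(** * Parseval's identity on a disc *)

Lemma cmod_ge0 (R : realType) (z : R[i]) : 0 <= cmod z.
Proof. by case: z => x y; exact: sqrtr_ge0. Qed.

Lemma cmodE (R : realType) (z : R[i]) : `|z| = (cmod z)%:C%C.
Proof. by case: z. Qed.

Lemma cmod0 (R : realType) : cmod (0 : R[i]) = 0.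
Proof. exact: ComplexField.Normc.normc0. Qed.

Lemma cmod1 (R : realType) : cmod (1 : R[i]) = 1.
Proof. exact: ComplexField.Normc.normc1. Qed.

Lemma cmodM (R : realType) (z w : R[i]) : cmod (z * w) = cmod z * cmod w.
Proof. exact: ComplexField.Normc.normcM. Qed.

Lemma cmodV (R : realType) (z : R[i]) : cmod z^-1 = (cmod z)^-1.
Proof. exact: ComplexField.Normc.normcV. Qed.

Lemma cmodX (R : realType) (z : R[i]) n : cmod (z ^+ n) = cmod z ^+ n.
Proof. by elim: n => [|n IH]; rewrite ?expr0 ?cmod1 // !exprS cmodM IH. Qed.

Lemma cmodN (R : realType) (z : R[i]) : cmod (- z) = cmod z.
Proof. by case: z => x y; rewrite /cmod /= !sqrrN. Qed.

Lemma cmodD (R : realType) (z w : R[i]) : cmod (z + w) <= cmod z + cmod w.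
Proof. by rewrite -lecR rmorphD /= -!cmodE ler_normD. Qed.

Lemma cmod_conj (R : realType) (z : R[i]) : cmod z^*%C = cmod z.
Proof. by case: z => x y; rewrite /cmod /= sqrrN. Qed.

Lemma cmod_real (R : realType) (x : R) : cmod x%:C%C = `|x|.
Proof. by rewrite /cmod /= expr0n addr0 sqrtr_sqr. Qed.

Lemma cmod_sum (R : realType) I (s : seq I) (P : pred I) (F : I -> R[i]) :
  cmod (\sum_(i <- s | P i) F i) <= \sum_(i <- s | P i) cmod (F i).
Proof.
elim/big_rec2: _ => [|i x y _ H]; first by rewrite cmod0.
by apply: le_trans (cmodD _ _ _) _; rewrite lerD2l.
Qed.

Lemma sqr_cmod (R : realType) (z : R[i]) :
  cmod z ^+ 2 = complex.Re z ^+ 2 + complex.Im z ^+ 2.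
Proof. by case: z => x y;
  rewrite /cmod /= sqr_sqrtr // addr_ge0 // sqr_ge0. Qed.

Lemma norm_Re_le_cmod (R : realType) (z : R[i]) : `|complex.Re z| <= cmod z.
Proof.
by case: z => x y; rewrite /cmod /= -sqrtr_sqr ler_wsqrtr // lerDl sqr_ge0.
Qed.

Lemma Re_mul_conj (R : realType) (z w : R[i]) :
  complex.Re (z * w^*%C) =
  complex.Re z * complex.Re w + complex.Im z * complex.Im w.
Proof. by case: z w => [a b] [c d] /=; rewrite mulrN opprK. Qed.

Lemma sqr_cmod_sum (R : realType) n (F : 'I_n -> R[i]) :
  cmod (\sum_i F i) ^+ 2 = \sum_i \sum_j complex.Re (F i * (F j)^*%C).
Proof.
have -> : cmod (\sum_i F i) ^+ 2 =
    complex.Re ((\sum_i F i) * (\sum_i F i)^*%C).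
  by rewrite Re_mul_conj sqr_cmod !expr2.
rewrite rmorph_sum mulr_suml /=.
have ReD : {morph (@complex.Re R) : x y / x + y} by case=> ? ? [].
rewrite (big_morph (@complex.Re R) ReD (erefl : complex.Re 0 = 0)).
apply: eq_bigr => i _; rewrite mulr_sumr.
by rewrite (big_morph (@complex.Re R) ReD (erefl : complex.Re 0 = 0)).
Qed.

(** * Measurability of complex-valued functions on the plane *)

Definition measurable_complex (R : realType)
    (D : set (measurableTypeR R * measurableTypeR R)) (f : R * R -> R[i]) :=
  measurable_fun D (fun q => complex.Re (f q)) /\
  measurable_fun D (fun q => complex.Im (f q)).

Section measurable_complex_closure.
Variables (R : realType) (D : set (measurableTypeR R * measurableTypeR R)).
Implicit Types f g : R * R -> R[i].
Local Notation mC := (measurable_complex R D).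

Lemma measurable_complex_cst c : mC (fun => c).
Proof. by split; exact: measurable_cst. Qed.

Lemma measurable_complex_pt : mC (fun q => pt q).
Proof. by split; apply: measurable_funTS;
  [exact: measurable_fst|exact: measurable_snd]. Qed.

Lemma measurable_complexD f g : mC f -> mC g -> mC (fun q => f q + g q).
Proof.
move=> [f1 f2] [g1 g2]; split.
  rewrite (_ : (fun q => _) = (fun q => complex.Re (f q) + complex.Re (g q))).
    exact: measurable_funD.
  by apply/funext => q; case: (f q) (g q) => ? ? [].
rewrite (_ : (fun q => _) = (fun q => complex.Im (f q) + complex.Im (g q))).
  exact: measurable_funD.
by apply/funext => q; case: (f q) (g q) => ? ? [].
Qed.

Lemma measurable_complexM f g : mC f -> mC g -> mC (fun q => f q * g q).
Proof.
move=> [f1 f2] [g1 g2]; split.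
  rewrite (_ : (fun q => _) = (fun q => complex.Re (f q) * complex.Re (g q) -
    complex.Im (f q) * complex.Im (g q))).
    by apply: measurable_funB; exact: measurable_funM.
  by apply/funext => q; case: (f q) (g q) => ? ? [].
rewrite (_ : (fun q => _) = (fun q => complex.Re (f q) * complex.Im (g q) +
  complex.Im (f q) * complex.Re (g q))).
  by apply: measurable_funD; exact: measurable_funM.
by apply/funext => q; case: (f q) (g q) => ? ? [].
Qed.

Lemma measurable_complexX f n : mC f -> mC (fun q => f q ^+ n).
Proof.
move=> mf; elim: n => [|n IH]; first exact: measurable_complex_cst.
under eq_fun do rewrite exprS.
exact: measurable_complexM.
Qed.

Lemma measurable_complex_conj f : mC f -> mC (fun q => (f q)^*%C).
Proof.
move=> [f1 f2]; split.
  rewrite (_ : (fun q => _) = (fun q => complex.Re (f q))) //.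
  by apply/funext => q; case: (f q).
rewrite (_ : (fun q => _) = (fun q => - complex.Im (f q))).
  exact: measurable_funN.
by apply/funext => q; case: (f q).
Qed.

Lemma measurable_complex_sum I (s : seq I) (F : I -> R * R -> R[i]) :
  (forall i, mC (F i)) -> mC (fun q => \sum_(i <- s) F i q).
Proof.
move=> mF; elim: s => [|i s IH].
  by under eq_fun do rewrite big_nil; exact: measurable_complex_cst.
by under eq_fun do rewrite big_cons; exact: measurable_complexD.
Qed.

Lemma measurable_sqr_cmod f : mC f -> measurable_fun D (fun q => cmod (f q) ^+
  2).
Proof.
move=> [f1 f2]; under eq_fun do rewrite sqr_cmod.
by apply: measurable_funD; exact: measurable_funX.
Qed.

End measurable_complex_closure.

Lemma plane_measure_disc_fin (R : realType) (s : R) :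
  (plane_measure R (disc R s) < +oo)%E.
Proof.
have [s0|s0] := leP 0 s; first by rewrite [ltLHS]plane_measure_disc // ltry.
rewrite (_ : disc R s = set0) ?measure0 // ; apply/seteqP; split => // q.
by move=> /lt_trans/(_ s0); rewrite ltNge cmod_ge0.
Qed.

Lemma integrable_disc_Re (R : realType) (s M : R) (f : R * R -> R[i]) :
  measurable_complex R setT f -> (forall q, disc R s q -> cmod (f q) <= M) ->
  (plane_measure R).-integrable (disc R s) (fun q => (complex.Re (f q))%:E).
Proof.
move=> [mf _] fM.
have mfs := measurable_funTS mf.
apply: (measurable_bounded_integrable (measurable_disc R s)
  (plane_measure_disc_fin R s) (mfs _)).
exists M; split; first exact: num_real.
move=> x Mx q sq /=; apply: le_trans (norm_Re_le_cmod _ _) _.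
exact: le_trans (fM q sq) (ltW Mx).
Qed.

Lemma integral_rotation (R : realType) (w : R[i]) (s : R) (f : R[i] -> R) :
  cmod w = 1 -> measurable_fun setT (fun q : R * R => f (pt q)) ->
  (plane_measure R).-integrable (disc R s) (fun q => (f (w * pt q))%:E) ->
  (\int[plane_measure R]_(q in disc R s) (f (pt q))%:E =
   \int[plane_measure R]_(q in disc R s) (f (w * pt q))%:E)%E.
Proof.
case: w => c d cd mf intf.
set T := fun q : measurableTypeR R * measurableTypeR R =>
  ((c * q.1 - d * q.2 : measurableTypeR R),
   (d * q.1 + c * q.2 : measurableTypeR R)).
have cd1 : c ^+ 2 + d ^+ 2 = 1.
  move: cd; rewrite /cmod /= => cd.
  by rewrite -[LHS]sqr_sqrtr ?cd ?expr1n // addr_ge0 // sqr_ge0.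
have [mT T_mu] := preserves_rotation R c d cd1.
have ptT q : pt (T q) = (c +i* d)%C * pt q.
  by apply/eqP; rewrite eq_complex /= eqxx [d * _ + _]addrC eqxx.
have TD : T @^-1` disc R s = disc R s.
  apply/seteqP; split => q; rewrite /disc /preimage /mkset ptT cmodM cd mul1r;
    exact.
pose mu : {measure set (measurableTypeR R * measurableTypeR R) -> \bar R} :=
  pushforward (plane_measure R) T.
transitivity (\int[mu mT]_(q in disc R s) (f (pt q))%:E)%E.
  by apply: eq_measure_integral => A mA _; apply/esym/T_mu.
rewrite /mu integral_pushforward //.
- by rewrite TD; apply: eq_integral => q _ /=; rewrite -ptT.
- exact/measurable_EFinP.
- rewrite TD; move: intf; congr (integrable _ _ _).
  by apply/funext => q /=; rewrite -ptT.
- exact: measurable_disc.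
Qed.

Lemma integral_disc_monomials_orthogonal (R : realType) (s : R) (a b : R[i])
    (j k : nat) : 0 <= s -> (k < j)%N ->
  (\int[plane_measure R]_(q in disc R s)
    (complex.Re ((a * pt q ^+ j) * (b * pt q ^+ k)^*%C))%:E = 0)%E.
Proof.
move=> s0 kj.
pose f z := complex.Re ((a * z ^+ j) * (b * z ^+ k)^*%C).
have d0 : (0 < j - k)%N by rewrite subn_gt0.
(* Any complex root of -1 of order j - k serves: its modulus is 1 because a power of it is. *)
pose w : R[i] := (j - k).-root (-1).
have wd : w ^+ (j - k) = -1 by rewrite /w rootCK.
have w1 : cmod w = 1.
  apply/eqP; rewrite -(@pexpr_eq1 _ _ (j - k)) ?cmod_ge0 //.
  by rewrite -cmodX wd cmodN cmod1.
have fw z : f (w * z) = - f z.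
  have ww : w ^+ k * (w ^+ k)^*%C = 1.
    by rewrite -sqr_normc cmodE cmodX w1 expr1n expr1n.
  rewrite /f !exprMn -(subnK (ltnW kj)) [w ^+ (_ + _)]exprD wd subnK 1?ltnW //.
  have -> : a * (-1 * w ^+ k * z ^+ j) * (b * (w ^+ k * z ^+ k))^*%C =
     - (a * z ^+ j * (b * z ^+ k)^*%C) * (w ^+ k * (w ^+ k)^*%C).
    by rewrite !rmorphM /=; ring.
  by rewrite ww mulr1; case: (_ * _).
have mF : measurable_complex R setT
    (fun q => (a * pt q ^+ j) * (b * pt q ^+ k)^*%C).
  apply: measurable_complexM; last apply: measurable_complex_conj;
    (apply: measurable_complexM; [exact: measurable_complex_cst|
     apply: measurable_complexX; exact: measurable_complex_pt]).
have intf : (plane_measure R).-integrable (disc R s) (fun q => (f (pt q))%:E).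
  apply: (@integrable_disc_Re _ _ (cmod a * s ^+ j * (cmod b * s ^+ k))) => //.
  move=> q /ltW sq; rewrite cmodM cmod_conj !cmodM !cmodX.
  by rewrite ler_pM ?mulr_ge0 ?exprn_ge0 ?cmod_ge0 // ler_wpM2l ?cmod_ge0 //
    lerXn2r // nnegrE cmod_ge0.
have intfN : (plane_measure R).-integrable (disc R s) (fun q => (- f (pt
  q))%:E).
  exact: (integrableN intf).
have E : (\int[plane_measure R]_(q in disc R s) (f (pt q))%:E =
    - \int[plane_measure R]_(q in disc R s) (f (pt q))%:E)%E.
  rewrite {1}(integral_rotation R w s f w1 mF.1); last first.
    by under eq_fun do rewrite fw.
  rewrite -integralN; last by apply: integrable_add_def;
    [exact: measurable_disc|exact: intf].
  by apply: eq_integral => q _; rewrite fw.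
move: E (integrable_fin_num (measurable_disc R s) intf); rewrite -/(f _).
case: (\int[_]_(_ in _) _)%E => // x [] x0 _; congr EFin; lra.
Qed.

Lemma parseval_disc (R : realType) (s : R) (c : nat -> R[i]) (n : nat) :
  0 <= s ->
  (\int[plane_measure R]_(q in disc R s)
     (cmod (\sum_(k < n) c k * pt q ^+ k) ^+ 2)%:E =
   (pi * \sum_(k < n) cmod (c k) ^+ 2 * s ^+ (k.+1).*2 / k.+1%:R)%:E)%E.
Proof.
move=> s0.
pose G j k (q : R * R) := complex.Re ((c j * pt q ^+ j) * (c k * pt q ^+
  k)^*%C).
have intG j k : (plane_measure R).-integrable (disc R s) (fun q => (G j k
  q)%:E).
  apply: (@integrable_disc_Re _ _ (cmod (c j) * s ^+ j * (cmod (c k) * s ^+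
    k))).
    apply: measurable_complexM; last apply: measurable_complex_conj;
      (apply: measurable_complexM; [exact: measurable_complex_cst|
       apply: measurable_complexX; exact: measurable_complex_pt]).
  move=> q /ltW sq; rewrite cmodM cmod_conj !cmodM !cmodX.
  by rewrite ler_pM ?mulr_ge0 ?exprn_ge0 ?cmod_ge0 // ler_wpM2l ?cmod_ge0 //
    lerXn2r // nnegrE cmod_ge0.
transitivity (\sum_(j < n) \sum_(k < n)
    \int[plane_measure R]_(q in disc R s) (G j k q)%:E)%E.
  under eq_integral do rewrite sqr_cmod_sum -sumEFin.
  under eq_integral do under eq_bigr do rewrite -sumEFin.
  rewrite integral_sum; last 2 first.
  - exact: measurable_disc.
  - by move=> j; apply: integrable_sum; [exact: measurable_disc|move=> k _;
    exact: intG].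
  apply: eq_bigr => j _; rewrite integral_sum;
    [by []|exact: measurable_disc|move=> k; exact: intG].
rewrite mulr_sumr -sumEFin; apply: eq_bigr => j _.
rewrite (bigD1 j) //= big1 ?adde0; last first.
  move=> k kj; case: (ltngtP k j) => [lt|lt|E].
  - exact: integral_disc_monomials_orthogonal.
  - transitivity (\int[plane_measure R]_(q in disc R s) (G k j q)%:E)%E.
      apply: eq_integral => q _; rewrite /G !Re_mul_conj; congr EFin; ring.
    exact: integral_disc_monomials_orthogonal.
  - by move: kj; rewrite -(inj_eq val_inj) /= E eqxx.
transitivity (\int[plane_measure R]_(q in disc R s)
  ((cmod (c j) ^+ 2)%:E * ((q.1 ^+ 2 + q.2 ^+ 2) ^+ j)%:E))%E.
  apply: eq_integral => q _; rewrite -EFinM /G Re_mul_conj -!expr2 -sqr_cmod.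
  by rewrite cmodM cmodX exprMn exprAC (sqr_cmod _ (pt q)).
rewrite ge0_integralZl_EFin; first 1 last.
- exact: measurable_disc.
- by move=> q _; rewrite lee_fin exprn_ge0 // addr_ge0 // sqr_ge0.
- by apply: measurable_funTS; exact: measurable_sqr_radius.
- exact: sqr_ge0.
by rewrite integral_disc_radius // -EFinM; congr EFin; ring.
Qed.

(** * Coefficients of bounded power series *)

Lemma cvg_cmodP (R : realType) (u : nat -> R[i]^o) (l : R[i]^o) :
  u @ \oo --> l <->
  forall e : R, 0 < e ->
    exists N, forall n, (N <= n)%N -> cmod (u n - l) < e.
Proof.
split=> [ul e e0|ul].
  have e0' : 0 < e%:C%C by rewrite ltcR.
  have /cvgrPdist_lt/(_ _ e0')[N _ H] := ul.
  exists N => n Nn; have := H n Nn.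
  by rewrite /= -opprB normrN cmodE ltcR.
apply/cvgrPdist_lt => e e0.
(* A positive element of [R[i]] is real, so complex tolerances reduce to real ones. *)
have eE : e = (complex.Re e)%:C%C by rewrite RRe_real // gtr0_real.
rewrite eE ltcR in e0; have [N H] := ul _ e0.
exists N => // n Nn /=.
by rewrite -opprB normrN cmodE eE ltcR; exact: H.
Qed.

Lemma geometric_sum_le (R : realFieldType) (q : R) (N M : nat) :
  0 <= q -> q < 1 -> \sum_(N <= k < M) q ^+ k <= q ^+ N / (1 - q).
Proof.
move=> q0 q1; have q1' : 0 < 1 - q by rewrite subr_gt0.
have [MN|NM] := leqP M N.
  by rewrite big_geq // divr_ge0 ?exprn_ge0 // ltW.
rewrite ler_pdivlMr // mulr_suml.
under eq_bigr do rewrite mulrBr mulr1 -exprSr -opprB.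
rewrite sumrN telescope_sumr 1?ltnW // opprB lerBlDr lerDl.
exact: exprn_ge0.
Qed.

Lemma expr_lt_eventually (R : realType) (q e : R) : 0 <= q -> q < 1 -> 0 < e ->
  exists N, forall n, (N <= n)%N -> q ^+ n < e.
Proof.
move=> q0 q1 e0.
have : (fun n => q ^+ n) @ \oo --> (0 : R).
  by apply: cvg_expr; rewrite ger0_norm.
move=> /cvgrPdist_lt/(_ _ e0)[N _ H]; exists N => n Nn.
by have := H n Nn; rewrite /= sub0r normrN ger0_norm // exprn_ge0.
Qed.

Section power_series.
Variables (R : realType) (f : R[i]^o -> R[i]^o) (a : nat -> R[i]^o).
Hypothesis fa : has_power_series f a.

Lemma power_series_cvg (z : R[i]) (e : R) : cmod z < 1 -> 0 < e ->
  exists N, forall n, (N <= n)%N ->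
    cmod (f z - \sum_(k < n) a k * z ^+ k) < e.
Proof.
move=> z1 e0; have /cvg_cmodP/(_ _ e0)[N H] := fa _ z1.
exists N => n /H; rewrite -cmodN opprB.
by rewrite /series /= big_mkord.
Qed.

Lemma power_series_coef_bound (t : R) : 0 <= t -> t < 1 ->
  exists2 C, 0 <= C & forall k, cmod (a k) * t ^+ k <= C.
Proof.
move=> t0 t1; have zt : cmod t%:C%C < 1 by rewrite cmod_real ger0_norm.
have [N H] := power_series_cvg _ _ zt ltr01.
have F0 k : 0 <= cmod (a k) * t ^+ k by rewrite mulr_ge0 ?cmod_ge0 ?exprn_ge0.
have S0 : 0 <= \sum_(k < N) cmod (a k) * t ^+ k by exact: sumr_ge0.
(* From [N] on, a term is the difference of two consecutive remainders, each below 1; the earlier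
   terms are absorbed by their sum. *)
exists (2 + \sum_(k < N) cmod (a k) * t ^+ k); first by rewrite addr_ge0.
move=> k; have [kN|Nk] := ltnP k N.
  rewrite (bigD1 (Ordinal kN)) //= addrCA lerDl addr_ge0 //.
  by apply: sumr_ge0 => i _.
have H1 := H k Nk; have H2 := H k.+1 (leqW Nk).
have -> : cmod (a k) * t ^+ k = cmod (a k * t%:C%C ^+ k).
  by rewrite cmodM cmodX cmod_real ger0_norm.
have -> : a k * t%:C%C ^+ k = (f t%:C%C - \sum_(j < k) a j * t%:C%C ^+ j) +
    - (f t%:C%C - \sum_(j < k.+1) a j * t%:C%C ^+ j).
  have E (u v w : R[i]) : w = (u - v) - (u - (v + w)) by ring.
  by rewrite big_ord_recr /=; exact: E.
apply: le_trans (cmodD _ _ _) _; rewrite cmodN.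
have := ltrD H1 H2; lra.
Qed.

(** Coefficients bounded at an intermediate radius t dominate the terms on |z| < s by a geometric
    series of ratio s / t. *)
Lemma power_series_uniform (s e : R) : 0 <= s -> s < 1 -> 0 < e ->
  exists N, forall n, (N <= n)%N -> forall z, cmod z < s ->
    cmod (f z - \sum_(k < n) a k * z ^+ k) <= e.
Proof.
move=> s0 s1 e0.
have [t [t0 st t1]] : exists t, [/\ 0 < t, s < t & t < 1].
  by exists ((s + 1) / 2); split; lra.
have [C C0 aC] := power_series_coef_bound t (ltW t0) t1.
set q := s / t; have q0 : 0 <= q by rewrite divr_ge0 // ltW.
have q1 : q < 1 by rewrite ltr_pdivrMr // mul1r.
have C1 : 0 < C + 1 by lra.
have q1' : 0 < 1 - q by lra.
have [N HN] := expr_lt_eventually R q (e / (C + 1) * (1 - q)) q0 q1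
  (mulr_gt0 (divr_gt0 e0 C1) q1').
exists N => n Nn z zs; apply/ler_addgt0Pr => d d0.
(* The index [m] depends on z and d, but only the block from n to [maxn n m] is estimated below, by
   a bound independent of [m]. *)
have [m Hm] := power_series_cvg z d (lt_trans zs s1) d0.
have {}Hm := Hm (maxn n m) (leq_maxr _ _).
have -> : f z - \sum_(k < n) a k * z ^+ k =
    (\sum_(n <= k < maxn n m) a k * z ^+ k) +
    (f z - \sum_(k < maxn n m) a k * z ^+ k).
  have E (u v w : R[i]) : u - v = w + (u - (v + w)) by ring.
  rewrite -!(big_mkord xpredT (fun k => a k * z ^+ k)).
  by rewrite (big_cat_nat (leq0n n) (leq_maxl n m)) /=; exact: E.
apply: le_trans (cmodD _ _ _) _; apply: lerD; last exact: ltW.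
apply: le_trans (cmod_sum _ _ _ _ _) _.
apply: (@le_trans _ _ (\sum_(n <= k < maxn n m) C * q ^+ k)).
  apply: ler_sum => k _; rewrite cmodM cmodX.
  rewrite /q expr_div_n mulrA ler_pdivlMr ?exprn_gt0 // mulrAC.
  apply: ler_pM; rewrite ?mulr_ge0 ?cmod_ge0 ?exprn_ge0 ?cmod_ge0 ?(ltW t0) //.
  by rewrite lerXn2r ?nnegrE ?cmod_ge0 // ltW.
rewrite -mulr_sumr.
apply: le_trans (ler_wpM2l C0 (geometric_sum_le _ _ _ _ q0 q1)) _.
have := HN n Nn; rewrite -ltr_pdivrMr // => /ltW H.
apply: (@le_trans _ _ (C * (e / (C + 1)))); first exact: ler_wpM2l.
by rewrite mulrA ler_pdivrMr // mulrC; nra.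
Qed.

End power_series.

(** * Square sums of the coefficients of a bounded function *)

Lemma parseval_disc_poly (R : realType) (s : R) (p : {poly R[i]}) (n : nat) :
  0 <= s -> (size p <= n)%N ->
  (\int[plane_measure R]_(q in disc R s) (cmod p.[pt q] ^+ 2)%:E =
   (pi * \sum_(k < n) cmod p`_k ^+ 2 * s ^+ (k.+1).*2 / k.+1%:R)%:E)%E.
Proof.
move=> s0 pn; rewrite -parseval_disc //.
by apply: eq_integral => q _; rewrite (horner_coef_wide _ pn).
Qed.

Lemma measurable_horner_pt (R : realType) D (p : {poly R[i]}) :
  measurable_complex R D (fun q => p.[pt q]).
Proof.
under eq_fun do rewrite horner_coef.
apply: measurable_complex_sum => k.
apply: measurable_complexM; first exact: measurable_complex_cst.
by apply: measurable_complexX; exact: measurable_complex_pt.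
Qed.

Lemma bernoulli_sub (R : realFieldType) (x : R) m : 0 <= x -> x <= 1 ->
  1 - m%:R * x <= (1 - x) ^+ m.
Proof.
move=> x0 x1; elim: m => [|m IH]; first by rewrite mul0r subr0 expr0.
rewrite exprS -natr1; have m0 : 0 <= m%:R :> R by rewrite ler0n.
have y0 : 0 <= 1 - x by lra.
have := ler_wpM2l y0 IH; nra.
Qed.

(** One parameter d drives three limits at once: (1 - d)^2 stands for two factors tending to 1 from
    below, a power of the radius and a ratio of weights, and (1 + d)^2 for the error in the bound on
    the Taylor polynomial. *)
Lemma le_of_factors_to1 (R : realFieldType) (x y : R) : 0 <= x -> 0 <= y ->
  (forall d, 0 < d -> d < 1 -> (1 - d) ^+ 2 * x <= (1 + d) ^+ 2 * y) -> x <= y.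
Proof.
move=> x0 y0 H; apply/ler_addgt0Pr => e e0.
have k0 : 0 < 2 * x + 3 * y + 1 by lra.
(* Expanding the hypothesis and using d^2 <= d leaves x <= y + d (2 x + 3 y); the added 1 keeps the
   divisor positive. *)
have [d [d0 d1 d2]] : exists d : R,
    [/\ 0 < d, d <= 1 / 2 & d * (2 * x + 3 * y + 1) <= e].
  exists (Num.min (1 / 2) (e / (2 * x + 3 * y + 1))); split.
  - by rewrite lt_min !divr_gt0.
  - by rewrite ge_min lexx.
  - by rewrite -ler_pdivlMr // ge_min lexx orbT.
have d3 : d < 1 by lra.
have h1 : 0 <= d * d * x by rewrite !mulr_ge0 // ltW.
have h2 : d * (d * y) <= 1 * (d * y).
  by apply: ler_wpM2r; [rewrite mulr_ge0 // ltW|exact: ltW].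
have := H d d0 d3; rewrite !expr2; lra.
Qed.

Lemma coef_poly_shift_perturb (R : realType) (a : nat -> R[i]) (c : R[i])
    (M N n i : nat) : (0 < n)%N -> (i <= n)%N -> (n < N)%N ->
  ('X^M * ((1 + c *: 'X^n) * \poly_(k < N) a k))`_(M + i) =
  a i + (i == n)%:R * (c * a 0%N).
Proof.
move=> n0 le_in nN; rewrite coefXnM ltnNge leq_addr /= addKn mulrDl mul1r coefD.
rewrite -scalerAl coefZ coefXnM !coef_poly (leq_ltn_trans le_in nN).
case: (ltngtP i n) le_in => // [lin _|-> _]; first by rewrite mulr0 mul0r.
by rewrite subnn (leq_ltn_trans _ nN) // mul1r.
Qed.

Lemma sum_window_le (R : realDomainType) (F : nat -> R) (M n m : nat) :
  (forall k, 0 <= F k) -> (M + n <= m)%N ->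
  \sum_(i < n) F (M + i)%N <= \sum_(k < m) F k.
Proof.
move=> F0 Mm; have Mn := leq_addr n M.
have S0 p r : 0 <= \sum_(p <= k < r) F k by apply: sumr_ge0.
rewrite -(big_mkord xpredT F) (big_cat_nat (leq0n _) Mm) /=.
rewrite (big_cat_nat (leq0n _) Mn) /=.
have -> : \sum_(i < n) F (M + i)%N = \sum_(M <= k < M + n) F k.
  elim: n {Mm Mn} => [|n IH]; first by rewrite big_ord0 addn0 big_geq.
  by rewrite big_ord_recr addnS big_nat_recr ?leq_addr //= IH.
by have := S0 0%N M; have := S0 (M + n)%N m; lra.
Qed.

Lemma sum_delta (R : pzRingType) (F : nat -> R) (M m : nat) : (M < m)%N ->
  \sum_(k < m) (k == M :> nat)%:R * F k = F M.
Proof.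
move=> Mm; rewrite (bigD1 (Ordinal Mm)) //= eqxx mul1r big1 ?addr0 // => k.
by rewrite -(inj_eq val_inj) /= => /negPf ->; rewrite mul0r.
Qed.

Section disc_bounded.
Variables (R : realType) (f : R[i]^o -> R[i]^o) (a : nat -> R[i]^o).
Hypothesis fB : classB f a.

Let fa : has_power_series f a. Proof. by case: fB. Qed.

Let f1 z : cmod z < 1 -> cmod (f z) <= 1. Proof. by case: fB => _ _; exact. Qed.

(** On |z| < s the Taylor polynomial [P] satisfies |P| <= 1 + e, so |z^M T P| <= (1 + e) |z^M T|
    pointwise. Squaring, integrating and applying Parseval to both sides compares the
    coefficients. *)
Lemma perturbed_coef_weighted (c : R[i]) (n M : nat) (s e : R) :
  (0 < n)%N -> 0 < s -> s < 1 -> 0 < e ->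
  s ^+ n.*2 * (M.+1%:R / (M + n).+1%:R) *
    (\sum_(k < n) cmod (a k) ^+ 2 + cmod (a n + c * a 0%N) ^+ 2)
  <= (1 + e) ^+ 2 * (1 + cmod c ^+ 2).
Proof.
move=> n0 s0 s1 e0.
have [N0 HN] := power_series_uniform R f a fa s e (ltW s0) s1 e0.
pose N := maxn N0 n.+1.
have {}HN := HN N (leq_maxl _ _).
have nN : (n < N)%N by rewrite leq_maxr.
pose P : {poly R[i]} := \poly_(k < N) a k.
pose T : {poly R[i]} := 1 + c *: 'X^n.
have P1 z : cmod z < s -> cmod P.[z] <= 1 + e.
  move=> zs; rewrite /P horner_poly.
  have := HN z zs; set S := \sum_(k < N) _ => H.
  have -> : S = f z + - (f z - S) by rewrite opprB addrC subrK.
  apply: le_trans (cmodD _ _ _) _; rewrite cmodN lerD // f1 //.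
  exact: lt_trans zs s1.
have mcmod (D : set (measurableTypeR R * measurableTypeR R)) (p : {poly R[i]}) :
    measurable_fun D (fun q => (cmod p.[pt q] ^+ 2)%:E).
  apply/measurable_EFinP.
  exact: (measurable_sqr_cmod _ _ _ (measurable_horner_pt _ _ _)).
have le1 : (\int[plane_measure R]_(q in disc R s)
      (cmod ('X^M * (T * P)).[pt q] ^+ 2)%:E <=
    ((1 + e) ^+ 2)%:E * \int[plane_measure R]_(q in disc R s)
      (cmod ('X^M * T).[pt q] ^+ 2)%:E)%E.
  rewrite -ge0_integralZl_EFin; first 1 last.
  - exact: measurable_disc.
  - by move=> q _; rewrite lee_fin sqr_ge0.
  - exact: mcmod.
  - exact: sqr_ge0.
  apply: ge0_le_integral.
  - exact: measurable_disc.
  - by move=> q _; rewrite lee_fin sqr_ge0.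
  - exact: mcmod.
  - by apply: measurable_funeM; exact: mcmod.
  - move=> q sq; rewrite -EFinM lee_fin mulrA hornerM cmodM exprMn mulrC.
    by rewrite ler_wpM2r ?sqr_ge0 // lerXn2r ?nnegrE ?cmod_ge0 ?P1 // addr_ge0
      // ltW.
(* A common length, so that both Parseval sums and the window of indices M to M + n share one
   range. *)
pose m := maxn (size ('X^M * (T * P))) (maxn (size ('X^M * T)) (M + n).+1).
have m1 : (size ('X^M * (T * P))%R <= m)%N by rewrite leq_maxl.
have m2 : (size ('X^M * T)%R <= m)%N by rewrite /m maxnCA leq_maxl.
have m3 : ((M + n).+1 <= m)%N by rewrite /m maxnA leq_maxr.
pose w k := s ^+ k.+1.*2 / k.+1%:R.
have w0 k : 0 < w k by rewrite divr_gt0 ?exprn_gt0 ?ltr0n.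
have Ew (p : {poly R[i]}) :
    \sum_(k < m) cmod p`_k ^+ 2 * s ^+ k.+1.*2 / k.+1%:R =
    \sum_(k < m) cmod p`_k ^+ 2 * w k.
  by apply: eq_bigr => k _; rewrite /w mulrA.
have {le1} : \sum_(k < m) cmod ('X^M * (T * P))`_k ^+ 2 * w k <=
    (1 + e) ^+ 2 * \sum_(k < m) cmod ('X^M * T)`_k ^+ 2 * w k.
  move: le1; rewrite (parseval_disc_poly _ _ _ _ (ltW s0) m1).
  rewrite (parseval_disc_poly _ _ _ _ (ltW s0) m2) -EFinM lee_fin [leRHS]mulrCA.
  rewrite ler_pM2l ?pi_gt0 //.
  by rewrite !Ew.
have -> : \sum_(k < m) cmod ('X^M * T)`_k ^+ 2 * w k =
    w M + cmod c ^+ 2 * w (M + n)%N.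
  rewrite -(sum_delta _ w M m) ?(leq_trans _ m3) ?ltnS ?leq_addr //.
  rewrite -(sum_delta _ (fun k => cmod c ^+ 2 * w k) (M + n) m) //.
  rewrite -big_split /=; apply: eq_bigr => k _;
    rewrite [_ * (cmod c ^+ 2 * _)]mulrA -mulrDl.
  congr (_ * _); rewrite mulrDr mulr1 coefD -scalerAr coefZ -exprD !coefXn.
  case: eqP => [->|_]; last first.
    by rewrite add0r cmodM; case: eqP => _;
      rewrite ?cmod1 ?cmod0 ?mulr1 ?mulr0 ?expr0n /= ?mul1r ?mul0r ?add0r.
  have -> : (M == M + n)%N = false by rewrite -{1}(addn0 M) eqn_add2l ltn_eqF.
  by rewrite mulr0 addr0 cmod1 expr1n mul0r addr0.
set X := \sum_(k < n) _ + _; move=> le2.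
(* The weights are nonincreasing, so w (M + n) bounds from below every weight in the window; its
   ratio to w M is the factor in the conclusion. *)
have wn : w (M + n)%N = s ^+ n.*2 * (M.+1%:R / (M + n).+1%:R) * w M.
  have x0 : M.+1%:R != 0 :> R by rewrite pnatr_eq0.
  have y0 : (M + n).+1%:R != 0 :> R by rewrite pnatr_eq0.
  rewrite /w -[in s ^+ _]addSn doubleD exprD.
  move: M.+1%:R (M + n).+1%:R x0 y0 => x y x0 y0.
  by field; rewrite ?x0 ?y0.
have wn_le : w (M + n)%N <= w M.
  rewrite wn ler_piMl ?(ltW (w0 M)) // mulr_ile1 ?exprn_ge0 ?divr_ge0 ?(ltW
    s0) //.
    by rewrite exprn_ile1 // ltW.
  by rewrite ler_pdivrMr ?ltr0n // mul1r ler_nat ltnS leq_addr.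
have XE : X = \sum_(i < n.+1) cmod ('X^M * (T * P))`_(M + i) ^+ 2.
  rewrite big_ord_recr /= coef_poly_shift_perturb // eqxx mul1r /X.
  congr (_ + _); apply: eq_bigr => i _.
  by rewrite coef_poly_shift_perturb // 1?ltnW // (ltn_eqF (ltn_ord i)) mul0r
    addr0.
have le3 : w (M + n)%N * X <= \sum_(k < m) cmod ('X^M * (T * P))`_k ^+ 2 * w k.
  have F0 k : 0 <= cmod ('X^M * (T * P))`_k ^+ 2 * w k.
    by rewrite mulr_ge0 ?sqr_ge0 // ltW.
  apply: le_trans (sum_window_le _ _ M n.+1 m F0 _); last by rewrite addnS.
  rewrite XE mulr_sumr; apply: ler_sum => i _;
    rewrite mulrC ler_wpM2l ?sqr_ge0 //.
  rewrite /w ler_pM ?exprn_ge0 ?invr_ge0 ?(ltW s0) //.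
    rewrite ler_wiXn2l // ?(ltW s0) ?(ltW s1) // leq_double ltnS leq_add2l.
    by rewrite -ltnS.
  by rewrite lef_pV2 ?posrE ?ltr0n // ler_nat ltnS leq_add2l -ltnS.
have le4 : w M + cmod c ^+ 2 * w (M + n)%N <= w M * (1 + cmod c ^+ 2).
  by rewrite mulrDr mulr1 lerD2l mulrC ler_wpM2r ?sqr_ge0.
have le5 := ler_wpM2l (sqr_ge0 (1 + e)) le4.
rewrite -(ler_pM2r (w0 M)) mulrAC -wn.
apply: le_trans le3 (le_trans le2 (le_trans le5 _)).
by rewrite mulrA mulrAC.
Qed.

(* Parseval for f (1 + c z^n) with the weight |z|^(2M) on a disc of radius s:
   as M grows and s tends to 1 the area integrals tend to means on the unit
   circle. *)
Lemma perturbed_coef (c : R[i]) (n : nat) : (0 < n)%N ->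
  \sum_(k < n) cmod (a k) ^+ 2 + cmod (a n + c * a 0%N) ^+ 2
  <= 1 + cmod c ^+ 2.
Proof.
move=> n0; set X := (X in X <= _).
have X0 : 0 <= X.
  by apply: addr_ge0; [apply: sumr_ge0 => i _|]; exact: sqr_ge0.
have Y0 : 0 <= 1 + cmod c ^+ 2 by rewrite addr_ge0 ?sqr_ge0.
have n0' : 0 < n.*2%:R :> R by rewrite ltr0n double_gt0.
have n1' : 1 <= n.*2%:R :> R by rewrite ler1n double_gt0.
apply: le_of_factors_to1 => // d d0 d1.
(* The radius is 1 - x: by Bernoulli, (1 - x)^(2n) >= 1 - d. Likewise M > n / d makes (M + 1) / (M +
   n + 1) >= 1 - d. *)
pose x := d / n.*2%:R; have x0 : 0 < x by rewrite divr_gt0.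
have x1 : x <= d by rewrite ler_pdivrMr // ler_peMr // ltW.
have s0 : 0 < 1 - x by lra.
have s1 : 1 - x < 1 by lra.
have [M nM] : exists M : nat, n%:R / d < M%:R.
  by exists (Num.truncn (n%:R / d)).+1; exact: truncnS_gt.
apply: le_trans (perturbed_coef_weighted c n M (1 - x) d n0 s0 s1 d0).
have d10 : 0 <= 1 - d by lra.
rewrite -/X ler_wpM2r // expr2 ler_pM //.
- have := bernoulli_sub _ x n.*2 (ltW x0) (le_trans x1 (ltW d1)).
  by rewrite {1}/x mulrC divfK // gt_eqF.
- rewrite ler_pdivlMr ?ltr0n //; move: nM; rewrite ltr_pdivrMr // => nM.
  rewrite -!natr1 natrD.
  have h1 : 0 <= M%:R :> R by []. have h2 : 0 <= n%:R :> R by [].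
  nra.
Qed.

End disc_bounded.

(** * Majorization by Moebius coefficients *)

Lemma abel_majorization (R : realDomainType) (w x y : nat -> R) (n : nat) :
  (forall k, 0 <= w k) -> (forall k, w k.+1 <= w k) ->
  (forall m, \sum_(k < m) x k <= \sum_(k < m) y k) ->
  \sum_(k < n) w k * x k <= \sum_(k < n) w k * y k.
Proof.
move=> w0 wS xy.
(* The boundary term of Abel summation is kept, so that the induction goes through. *)
suff : w n * (\sum_(k < n) y k - \sum_(k < n) x k) <=
    \sum_(k < n) w k * y k - \sum_(k < n) w k * x k.
  have : 0 <= w n * (\sum_(k < n) y k - \sum_(k < n) x k).
    by rewrite mulr_ge0 // subr_ge0.
  by lra.
elim: n => [|n IH]; first by rewrite !big_ord0 !subr0 mulr0.
have d0 : 0 <= \sum_(k < n.+1) y k - \sum_(k < n.+1) x k by rewrite subr_ge0.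
have := ler_wpM2r d0 (wS n); rewrite !big_ord_recr /=; lra.
Qed.

Lemma sum_arith_geom (R : comPzRingType) (q : R) n :
  (\sum_(k < n) k.+1%:R * q ^+ k) * (1 - q) ^+ 2 =
  1 - q ^+ n - n%:R * q ^+ n * (1 - q).
Proof.
elim: n => [|n IH]; first by rewrite big_ord0 !mul0r expr0 subrr subr0.
by rewrite big_ord_recr /= mulrDl IH (exprS q n) -natr1; ring.
Qed.

Lemma sum_arith_geom_le (R : realFieldType) (q : R) n : 0 <= q -> q < 1 ->
  \sum_(k < n) k.+1%:R * q ^+ k <= ((1 - q) ^+ 2)^-1.
Proof.
move=> q0 q1; have q2 : 0 < 1 - q by lra.
rewrite -[leRHS]mul1r ler_pdivlMr ?exprn_gt0 // sum_arith_geom.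
have qn : 0 <= q ^+ n by rewrite exprn_ge0.
have : 0 <= n%:R * q ^+ n * (1 - q) by rewrite !mulr_ge0 // ltW.
by lra.
Qed.

Section coefficient_bounds.
Variables (R : realType) (f : R[i]^o -> R[i]^o) (a : nat -> R[i]^o).
Hypothesis fB : classB f a.
Local Notation A := (cmod (a 0%N)).

Lemma cmod_coef_le1 k : cmod (a k) <= 1.
Proof.
rewrite -(@ler_pXn2r _ 2) ?nnegrE ?cmod_ge0 // expr1n.
(* With c = 0 this is Parseval's inequality; the positive index [k.+1] lets it cover a_0 as well. *)
have := perturbed_coef R f a fB 0 k.+1 isT.
rewrite cmod0 expr0n addr0 mul0r addr0 big_ord_recr /=.
have : 0 <= \sum_(i < k) cmod (a i) ^+ 2 by apply: sumr_ge0 => i _;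
  exact: sqr_ge0.
have := sqr_ge0 (cmod (a k.+1)); lra.
Qed.

Lemma sqr_coef_le n : (0 < n)%N ->
  cmod (a n) ^+ 2 <= (1 - A ^+ 2) * (1 - \sum_(k < n) cmod (a k) ^+ 2).
Proof.
move=> n0; have A0 := cmod_ge0 R (a 0%N); have A1 := cmod_coef_le1 0.
have A2 : A ^+ 2 <= 1 by rewrite expr_le1.
set S := \sum_(k < n) _.
(* For A = 1 the optimal c would have denominator 0; there c = 0 already forces a_n = 0. *)
move: A2; rewrite le_eqVlt => /predU1P[E|A2].
  have := perturbed_coef R f a fB 0 n n0.
  rewrite cmod0 expr0n addr0 mul0r addr0 -/S E subrr mul0r.
  have : A ^+ 2 <= S.
    rewrite /S; case: n n0 @S => // n _ /=; rewrite big_ord_recl lerDl.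
    by apply: sumr_ge0 => i _; exact: sqr_ge0.
  by rewrite E; lra.
set D := 1 - A ^+ 2; have D0 : 0 < D by rewrite subr_gt0.
have Dn0 : D%:C%C != 0 :> R[i] by rewrite -(rmorph0 (real_complex R)) (inj_eq
  (@complexI R)) gt_eqF.
(* This c maximises |a_n + c a_0|^2 - |c|^2, and the maximum is |a_n|^2 / (1 - A^2). *)
pose c : R[i] := (a 0%N)^*%C * a n / D%:C%C.
have := perturbed_coef R f a fB c n n0; rewrite -/S.
have cD x : cmod (x / D%:C%C) = cmod x / D.
  by rewrite cmodM cmodV cmod_real gtr0_norm.
have -> : a n + c * a 0%N = a n / D%:C%C.
  have E : (a 0%N)^*%C * a 0%N = 1 - D%:C%C :> R[i].
    rewrite mulrC -sqr_normc cmodE /D rmorphB /= rmorph1 rmorphXn /=.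
    by rewrite opprB addrC subrK.
  transitivity (a n * (D%:C%C + (a 0%N)^*%C * a 0%N) / D%:C%C).
    by rewrite /c; field.
  by rewrite E; field.
rewrite /c !cD cmodM cmod_conj !expr_div_n exprMn -/S.
set x := cmod (a n) ^+ 2; have -> : A ^+ 2 = 1 - D by rewrite /D; ring.
move=> H; rewrite mulrC -ler_pdivrMr //.
suff -> : x / D = x / D ^+ 2 - (1 - D) * x / D ^+ 2 by lra.
by field; rewrite gt_eqF.
Qed.

(* On the right are the coefficients of the Moebius map (A - z)/(1 - A z). *)
Lemma coef_energy n :
  \sum_(k < n) cmod (a k.+1) ^+ 2 <=
  \sum_(k < n) ((1 - A ^+ 2) * A ^+ k) ^+ 2.
Proof.
elim: n => [|n IH]; first by rewrite !big_ord0.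
have H := sqr_coef_le n.+1 isT; rewrite big_ord_recl in H.
rewrite [leLHS]big_ord_recr [leRHS]big_ord_recl /= expr0 mulr1.
(* Writing S_n for the sums, both sides satisfy S_(n+1) <= A^2 S_n + (1 - A^2)^2, the Moebius side
   with equality. *)
have -> : \sum_(i < n) ((1 - A ^+ 2) * A ^+ bump 0 i) ^+ 2 =
    A ^+ 2 * \sum_(i < n) ((1 - A ^+ 2) * A ^+ i) ^+ 2.
  rewrite mulr_sumr; apply: eq_bigr => i _.
  by rewrite /bump leq0n add1n (exprS A i); ring.
move: H (ler_wpM2l (sqr_ge0 A) IH).
rewrite -[\sum_(i < n) cmod (a (bump 0 i)) ^+ 2]/(\sum_(i < n) cmod (a i.+1)
  ^+ 2).
set S := \sum_(i < n) cmod (a i.+1) ^+ 2; set x := cmod (a n.+1) ^+ 2 => H H2.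
have -> : S + x = A ^+ 2 * S + ((1 - A ^+ 2) * S + x) by ring.
rewrite addrC lerD // -lerBrDl; apply: le_trans H _.
by rewrite le_eqVlt; apply/orP; left; apply/eqP; ring.
Qed.

(** With [b] the moduli of the Moebius coefficients and w = r^(k+1) / b, twice each term is w 2
    |a_(k+1)| b <= w |a_(k+1)|^2 + w b^2. Majorization bounds the sum of the first part by that of
    the second, which is the Moebius value. The hypothesis r <= A makes [w] nonincreasing. *)
Lemma sum_coef_le_moebius (r : R) n : 0 <= r -> 0 < A -> r <= A -> A < 1 ->
  \sum_(k < n) cmod (a k.+1) * r ^+ k.+1 <= r * (1 - A ^+ 2) / (1 - A * r).
Proof.
move=> r0 A0 rA A1.
have D0 : 0 < 1 - A ^+ 2 by rewrite subr_gt0 expr_lt1 // ltW.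
have Ar0 : 0 <= A * r by rewrite mulr_ge0 // ltW.
have Ar1 : A * r < 1 by nra.
pose b k := (1 - A ^+ 2) * A ^+ k.
have b0 k : 0 < b k by rewrite mulr_gt0 // exprn_gt0.
pose w k := r ^+ k.+1 / b k.
have w0 k : 0 <= w k by rewrite divr_ge0 ?exprn_ge0 // ltW.
have wS k : w k.+1 <= w k.
  rewrite /w ler_pdivrMr // mulrAC ler_pdivlMr // /b !exprS.
  have : 0 <= r * r ^+ k * ((1 - A ^+ 2) * A ^+ k).
    by rewrite !mulr_ge0 ?exprn_ge0 // ltW.
  by move=> h; have := ler_wpM2l h rA; lra.
have H1 := abel_majorization R w (fun k => cmod (a k.+1) ^+ 2)
  (fun k => ((1 - A ^+ 2) * A ^+ k) ^+ 2) n w0 wS coef_energy.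
have H2 : \sum_(k < n) cmod (a k.+1) * r ^+ k.+1 <= \sum_(k < n) r ^+ k.+1 * b
  k.
  have : \sum_(k < n) cmod (a k.+1) * r ^+ k.+1 *+ 2 <=
      \sum_(k < n) w k * cmod (a k.+1) ^+ 2 + \sum_(k < n) w k * b k ^+ 2.
    rewrite -big_split /=; apply: ler_sum => k _.
    have bk : b k != 0 by rewrite gt_eqF.
    have -> : cmod (a k.+1) * r ^+ k.+1 *+ 2 = w k * (2 * cmod (a k.+1) * b k).
      by rewrite /w; field.
    rewrite -mulrDr ler_wpM2l // -subr_ge0.
    by have := sqr_ge0 (cmod (a k.+1) - b k); rewrite sqrrB; lra.
  have -> : \sum_(k < n) w k * b k ^+ 2 = \sum_(k < n) r ^+ k.+1 * b k.
    apply: eq_bigr => k _; have bk : b k != 0 by rewrite gt_eqF.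
    by rewrite /w; field.
  have -> : \sum_(k < n) cmod (a k.+1) * r ^+ k.+1 *+ 2 =
      (\sum_(k < n) cmod (a k.+1) * r ^+ k.+1) *+ 2 by rewrite sumrMnl.
  move: H1.
  have -> : \sum_(k < n) w k * ((1 - A ^+ 2) * A ^+ k) ^+ 2 =
      \sum_(k < n) r ^+ k.+1 * b k.
    apply: eq_bigr => k _; have bk : b k != 0 by rewrite gt_eqF.
    by rewrite -/(b k) /w; field.
  by rewrite mulr2n; lra.
apply: le_trans H2 _.
have -> : \sum_(k < n) r ^+ k.+1 * b k =
    r * (1 - A ^+ 2) * \sum_(0 <= k < n) (A * r) ^+ k.
  rewrite big_mkord mulr_sumr; apply: eq_bigr => k _.
  by rewrite /b exprMn exprS; ring.
rewrite -mulrA; rewrite -mulrA ler_wpM2l // ler_wpM2l ?(ltW D0) //.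
have := geometric_sum_le R (A * r) 0 n Ar0 Ar1.
by rewrite expr0 div1r.
Qed.

Lemma sum_coef_le_cauchy (r : R) n : 0 < r -> r < 1 ->
  \sum_(k < n) cmod (a k.+1) * r ^+ k.+1 <=
  r / 2 * (1 + (1 - A ^+ 2) / (1 - r ^+ 2)).
Proof.
move=> r0 r1; have r2 : 0 < 1 - r ^+ 2 by rewrite subr_gt0 expr_lt1 // ltW.
(* The scale in u v <= t u^2 / 2 + v^2 / (2 t) that is optimal at A = r; the bound is then r, as for
   the Moebius map of parameter r. *)
pose t := r / (1 - r ^+ 2); have t0 : 0 < t by rewrite divr_gt0.
have H1 : \sum_(k < n) cmod (a k.+1) ^+ 2 <= 1 - A ^+ 2.
  have := perturbed_coef R f a fB 0 n.+1 isT.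
  rewrite cmod0 expr0n addr0 mul0r addr0 big_ord_recl /=.
  have := sqr_ge0 (cmod (a n.+1)).
  by under eq_bigr do rewrite /bump leq0n add1n; lra.
have H2 : \sum_(k < n) (r ^+ 2) ^+ k.+1 <= r ^+ 2 / (1 - r ^+ 2).
  under eq_bigr do rewrite exprS; rewrite -mulr_sumr ler_wpM2l ?sqr_ge0 //.
  have q1 : r ^+ 2 < 1 by rewrite -subr_gt0.
  have := geometric_sum_le R (r ^+ 2) 0 n (sqr_ge0 r) q1.
  by rewrite expr0 div1r big_mkord.
apply: (@le_trans _ _ (\sum_(k < n)
    (t / 2 * cmod (a k.+1) ^+ 2 + (r ^+ 2) ^+ k.+1 / (2 * t)))).
  apply: ler_sum => k _; rewrite exprAC.
  set u := cmod _; set v := r ^+ k.+1.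
  have -> : t / 2 * u ^+ 2 + v ^+ 2 / (2 * t) =
    u * v + (t * u - v) ^+ 2 / (2 * t) by field; rewrite gt_eqF.
  by rewrite lerDl divr_ge0 ?sqr_ge0 // mulr_ge0 // ltW.
rewrite big_split /= -mulr_sumr -mulr_suml.
have t2 : 0 <= t / 2 by rewrite divr_ge0 // ltW.
have t3 : 0 <= (2 * t)^-1 by rewrite invr_ge0 mulr_ge0 // ltW.
apply: le_trans (lerD (ler_wpM2l t2 H1) (ler_wpM2r t3 H2)) _.
rewrite le_eqVlt; apply/orP; left; apply/eqP; rewrite /t.
by field; rewrite (gt_eqF r2) gt_eqF.
Qed.

Lemma sum_area_le (r : R) n : 0 <= r -> r <= 1 / 3 ->
  \sum_(k < n) k.+1%:R * cmod (a k.+1) ^+ 2 * r ^+ (k.+1).*2 <=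
  (r * (1 - A ^+ 2) / (1 - A ^+ 2 * r ^+ 2)) ^+ 2.
Proof.
move=> r0 r1; have A0 := cmod_ge0 R (a 0%N); have A1 := cmod_coef_le1 0.
have A2 : A ^+ 2 <= 1 by rewrite expr_le1.
have r2 : r ^+ 2 <= 1 / 9 by rewrite expr2; nra.
have q0 : 0 <= A ^+ 2 * r ^+ 2 by rewrite mulr_ge0 ?sqr_ge0.
have q1 : A ^+ 2 * r ^+ 2 < 1 by have := sqr_ge0 r; nra.
pose w k := k.+1%:R * (r ^+ 2) ^+ k.+1.
have w0 k : 0 <= w k by rewrite mulr_ge0 ?exprn_ge0 ?sqr_ge0.
(* This amounts to (k + 2) r^2 <= k + 1, which follows from r^2 <= 1/9. *)
have wS k : w k.+1 <= w k.
  rewrite /w [(r ^+ 2) ^+ k.+2]exprS mulrA ler_wpM2r ?exprn_ge0 ?sqr_ge0 //.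
  rewrite -natr1; have : 1 <= k.+1%:R :> R by rewrite ler1n.
  by have := sqr_ge0 r; nra.
have H := abel_majorization R w (fun k => cmod (a k.+1) ^+ 2)
  (fun k => ((1 - A ^+ 2) * A ^+ k) ^+ 2) n w0 wS coef_energy.
have -> : \sum_(k < n) k.+1%:R * cmod (a k.+1) ^+ 2 * r ^+ k.+1.*2 =
    \sum_(k < n) w k * cmod (a k.+1) ^+ 2.
  by apply: eq_bigr => k _; rewrite /w -exprM mul2n; ring.
apply: le_trans H _.
have -> : \sum_(k < n) w k * ((1 - A ^+ 2) * A ^+ k) ^+ 2 =
    (r * (1 - A ^+ 2)) ^+ 2 * \sum_(k < n) k.+1%:R * (A ^+ 2 * r ^+ 2) ^+ k.
  rewrite mulr_sumr; apply: eq_bigr => k _.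
  rewrite /w [(r ^+ 2) ^+ k.+1]exprS [((1 - A ^+ 2) * A ^+ k) ^+ 2]exprMn.
  by rewrite [(A ^+ k) ^+ 2]exprAC [(A ^+ 2 * r ^+ 2) ^+ k]exprMn; ring.
by rewrite expr_div_n ler_wpM2l ?sqr_ge0 // sum_arith_geom_le.
Qed.

End coefficient_bounds.

(** * The area integral as a power series *)

Lemma cmod_derive1_le (R : realType) (g : R[i]^o -> R[i]^o) (z : R[i]^o)
    (K d : R) :
  derivable g z 1 -> 0 < d ->
  (forall h, cmod h < d -> cmod (g (h + z) - g z) <= cmod h * K) ->
  cmod (derive1 g z) <= K.
Proof.
move=> dg d0 gK; apply/ler_addgt0Pr => e e0.
have cg : (fun h : R[i]^o => h^-1 *: (g (h + z) - g z)) @ 0^' --> derive1 g z.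
  rewrite derive1E; have := dg; rewrite /derivable /derive /=.
  by under eq_fun do rewrite [_ *: 1]mulr1.
have e0' : 0 < e%:C%C :> R[i] by rewrite ltcR.
have d0' : 0 < d%:C%C :> R[i] by rewrite ltcR.
have /cvgrPdist_lt/(_ _ e0') H1 := cg.
have H2 : \forall h \near (0 : R[i]^o)^', `|h| < d%:C%C by exact: dnbhs0_lt.
have H3 : \forall h \near (0 : R[i]^o)^', h != 0 by exact: nbhs_dnbhs_neq.
have [h [[h1 h2] h3]] := filter_ex (filterI (filterI H1 H2) H3).
rewrite cmodE ltcR in h2; rewrite cmodE ltcR in h1.
set q := h^-1 *: _ in h1.
have -> : derive1 g z = (derive1 g z - q) + q by rewrite subrK.
apply: le_trans (cmodD _ _ _) _; rewrite addrC lerD ?(ltW h1) //.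
have h0 : 0 < cmod h.
  rewrite lt_neqAle cmod_ge0 andbT eq_sym; apply/eqP => hh.
  by move/eqP: h3; apply; apply/eqP; rewrite -normr_eq0 cmodE hh.
rewrite /q [_ *: _]/(_ * _) cmodM.
rewrite -[K](mulKf (lt0r_neq0 h0)) [leLHS]/(_ * _).
by rewrite cmodV ler_wpM2l ?invr_ge0 ?cmod_ge0 // gK.
Qed.

Lemma is_derive_horner_complex (R : realType) (p : {poly R[i]}) (z : R[i]^o) :
  is_derive z (1 : R[i]^o) (horner p : R[i]^o -> R[i]^o) p^`().[z].
Proof.
elim/poly_ind: p => [|p c IH].
  rewrite deriv0 horner0 (_ : horner 0 = cst 0); first exact: is_derive_cst.
  by apply/funext => x; rewrite horner0.
have -> : (horner (p * 'X + c%:P) : R[i]^o -> R[i]^o) =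
    (horner p : R[i]^o -> R[i]^o) * id + cst c.
  by apply/funext => x; rewrite hornerMXaddC.
have := is_deriveD (is_deriveM IH (is_derive_id z (1 : R[i]^o)))
  (is_derive_cst (c : R[i]^o) z (1 : R[i]^o)).
congr (is_derive _ _ _ _).
rewrite derivMXaddC hornerD hornerMX addr0.
by rewrite -![_ *: _]/(_ * _) mulr1 [z * _]mulrC addrC.
Qed.

Lemma cmod_subX_le (R : realType) (s : R) (z w : R[i]) k :
  cmod z <= s -> cmod w <= s ->
  cmod (w ^+ k - z ^+ k) <= cmod (w - z) * (k%:R * s ^+ k.-1).
Proof.
move=> zs ws; case: k => [|k]; first by rewrite !expr0 subrr cmod0 mul0r mulr0.
rewrite subrXX cmodM ler_wpM2l ?cmod_ge0 //=.
apply: le_trans (cmod_sum _ _ _ _ _) _.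
rewrite -[in leRHS](card_ord k.+1) mulr_natl -sumr_const.
apply: ler_sum => i _; rewrite cmodM !cmodX /=.
have -> : s ^+ k = s ^+ (k - i) * s ^+ i by rewrite -exprD subnK // leq_ord.
by rewrite ler_pM ?exprn_ge0 ?cmod_ge0 // lerXn2r ?nnegrE ?cmod_ge0 //
  (le_trans (cmod_ge0 _ _) zs).
Qed.

(** The factor k produced by differentiation at radius 1/2 is absorbed by enlarging the ratio to
    3/4. *)
Lemma half_pow_le (R : realFieldType) k :
  k%:R * (1 / 2) ^+ k.-1 <= 4 * (3 / 4) ^+ k :> R.
Proof.
have H : forall n, 2 + n%:R <= 2 * (3 / 2) ^+ n :> R.
  elim=> [|n IH]; first by rewrite expr0; lra.
  have : 0 <= n%:R :> R by []. rewrite exprS -[n.+1%:R]natr1; lra.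
case: k => [|k]; first by rewrite mul0r mulr_ge0 ?exprn_ge0 //; lra.
rewrite /= exprS; have -> : (3 / 4 : R) = (1 / 2) * (3 / 2) by field.
rewrite [(1 / 2 * (3 / 2)) ^+ k]exprMn.
have h0 : 0 <= (1 / 2 : R) ^+ k by rewrite exprn_ge0.
have h1 : 0 <= (1 / 2 : R) ^+ k * (3 / 2) ^+ k.
  by rewrite mulr_ge0 ?exprn_ge0 //; lra.
have := ler_wpM2r h0 (H k); rewrite -[k.+1%:R]natr1; lra.
Qed.

Section derivative.
Variables (R : realType) (f : R[i]^o -> R[i]^o) (a : nat -> R[i]^o).
Hypothesis fB : classB f a.

Let fa : has_power_series f a. Proof. by case: fB. Qed.

Definition taylor_poly n : {poly R[i]} := \poly_(k < n) a k.
Local Notation P := taylor_poly.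

(** This is the route to termwise differentiation: a Lipschitz bound survives pointwise limits, and
    [cmod_derive1_le] turns it into a bound on f' - P_n'. Each |a_k| is at most 1 and z^k has
    Lipschitz constant at most 4 (3/4)^k, so the tail sums to 16 (3/4)^n. The radius 1/2 leaves a
    margin around the discs r <= 1/3. *)
Lemma taylor_remainder_lipschitz n (z w : R[i]) :
  cmod z <= 1 / 2 -> cmod w <= 1 / 2 ->
  cmod ((f w - (P n).[w]) - (f z - (P n).[z])) <=
  cmod (w - z) * (16 * (3 / 4) ^+ n).
Proof.
move=> z2 w2; apply/ler_addgt0Pr => e e0.
have e2 : 0 < e / 2 by rewrite divr_gt0.
have z1 : cmod z < 1 by apply: le_lt_trans z2 _; lra.
have w1 : cmod w < 1 by apply: le_lt_trans w2 _; lra.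
have [N1 H1] := power_series_cvg R f a fa z (e / 2) z1 e2.
have [N2 H2] := power_series_cvg R f a fa w (e / 2) w1 e2.
pose m := maxn n (maxn N1 N2).
have {}H1 := H1 m; have {}H2 := H2 m.
have nm : (n <= m)%N by rewrite leq_maxl.
have {}H1 := H1 (leq_trans (leq_maxl _ _) (leq_maxr _ _)).
have {}H2 := H2 (leq_trans (leq_maxr _ _) (leq_maxr _ _)).
set F := fun x : R[i] => f x - \sum_(k < m) a k * x ^+ k.
have D x : f x - (P n).[x] = F x + \sum_(n <= k < m) a k * x ^+ k.
  rewrite /F horner_poly -!(big_mkord xpredT (fun k => a k * x ^+ k)).
  rewrite (big_cat_nat (leq0n n) nm) /=.
  have E (u v t : R[i]) : u - v = u - (v + t) + t by ring.
  exact: E.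
have E (u v s t : R[i]) : u + v - (s + t) = (v - t) + (u - s) by ring.
rewrite !D E; apply: le_trans (cmodD _ _ _) _; apply: lerD; last first.
  apply: le_trans (cmodD _ _ _) _; rewrite cmodN.
  by have := ltrD H1 H2; rewrite -/(F z) -/(F w); lra.
rewrite -sumrB; apply: le_trans (cmod_sum _ _ _ _ _) _.
apply: (@le_trans _ _ (cmod (w - z) * \sum_(n <= k < m) 4 * (3 / 4) ^+ k)).
  rewrite mulr_sumr; apply: ler_sum => k _.
  rewrite -mulrBr cmodM; apply: (@le_trans _ _ (1 * cmod (w ^+ k - z ^+ k))).
    by rewrite ler_wpM2r ?cmod_ge0 // (cmod_coef_le1 R f a fB).
  rewrite mul1r; apply: le_trans (cmod_subX_le _ _ _ _ k z2 w2) _.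
  by rewrite ler_wpM2l ?cmod_ge0 // half_pow_le.
rewrite ler_wpM2l ?cmod_ge0 // -mulr_sumr.
have q0 : 0 <= 3 / 4 :> R by lra.
have q1 : 3 / 4 < 1 :> R by lra.
have := geometric_sum_le R (3 / 4) n m q0 q1.
have -> : 1 - 3 / 4 = 4^-1 :> R by field.
by rewrite invrK; lra.
Qed.

Lemma derive1_taylor n (z : R[i]^o) : cmod z < 1 / 2 ->
  cmod (derive1 f z - (P n)^`().[z]) <= 16 * (3 / 4) ^+ n.
Proof.
move=> z2; have z1 : cmod z < 1 by apply: lt_trans z2 _; lra.
have df : derivable f z 1 by case: fB => + _ _; exact.
have dP := is_derive_horner_complex R (P n) z.
pose g : R[i]^o -> R[i]^o := f - (horner (P n) : R[i]^o -> R[i]^o).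
have Df : is_derive z (1 : R[i]^o) f ('D_1 f z) by exact/derivableP.
have [dg Dg] := is_deriveB Df dP.
have -> : derive1 f z - (P n)^`().[z] = derive1 g z.
  by rewrite [in RHS]derive1E [in LHS]derive1E; apply/esym; exact: Dg.
have d0 : 0 < 1 / 2 - cmod z by rewrite subr_gt0.
apply: (@cmod_derive1_le _ g z _ (1 / 2 - cmod z) dg d0).
move=> h hd; have := taylor_remainder_lipschitz n z (h + z) (ltW z2).
rewrite addrK; apply; apply: le_trans (cmodD _ _ _) _; lra.
Qed.

Lemma deriv_taylor_bound n (z : R[i]) : cmod z < 1 / 2 ->
  cmod (P n)^`().[z] <= 32.
Proof.
move=> z2.
(* Degree bound 0 has zero polynomial, so |f'| <= 16; adding the error, again at most 16, gives
   32. *)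
have H0 := derive1_taylor 0 z z2; have Hn := derive1_taylor n z z2.
move: H0; rewrite /P poly_def big_ord0 deriv0 horner0 subr0 expr0 mulr1 => H0.
have -> : (P n)^`().[z] = derive1 f z + - (derive1 f z - (P n)^`().[z]).
  by rewrite opprB addrC subrK.
apply: le_trans (cmodD _ _ _) _; rewrite cmodN.
have : (3 / 4) ^+ n <= 1 :> R by rewrite exprn_ile1 //; lra.
by lra.
Qed.

End derivative.

Section area.
Variables (R : realType) (f : R[i]^o -> R[i]^o) (a : nat -> R[i]^o).
Hypothesis fB : classB f a.
Variable r : R.
Hypotheses (r0 : 0 <= r) (r1 : r <= 1 / 3).
Local Notation P := (taylor_poly R a).

Let disc_half q : disc R r q -> cmod (pt q) < 1 / 2.
Proof.
have r2 : r < 1 / 2 by move: r1; lra.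
by move=> h; exact: lt_trans h r2.
Qed.

(* 1280 = 16 * 80, where 80 bounds |f'| + |P_n'|. *)
Lemma sqr_cmod_derive1_taylor n (z : R[i]) : cmod z < 1 / 2 ->
  `|cmod (derive1 f z) ^+ 2 - cmod (P n)^`().[z] ^+ 2| <= 1280 * (3 / 4) ^+ n.
Proof.
move=> z2; have H := derive1_taylor R f a fB n z z2.
have := deriv_taylor_bound R f a fB n z z2.
have q0 : 0 <= (3 / 4) ^+ n :> R by rewrite exprn_ge0 //; lra.
have q1 : (3 / 4) ^+ n <= 1 :> R by rewrite exprn_ile1 //; lra.
move: H; set x := (X in cmod (X - _)); set y := _.[z] => H y32.
have xy : cmod x <= cmod y + cmod (x - y).
  by have := cmodD R y (x - y); rewrite addrC subrK addrC.
have yx : cmod y <= cmod x + cmod (x - y).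
  have := cmodD R x (- (x - y)); rewrite cmodN opprB addrC subrK.
  exact.
have x0 := cmod_ge0 R x; have y0 := cmod_ge0 R y.
move: xy yx H x0 y0 y32; move: (cmod (x - y)) (cmod x) (cmod y) => d u v.
move=> xy yx H x0 y0 y32;
  rewrite subr_sqr normrM [`|u + v|]ger0_norm ?addr_ge0 //.
have uv : `|u - v| <= 16 * (3 / 4) ^+ n.
  by apply: le_trans H; rewrite ler_norml; apply/andP; split; lra.
(* Here v <= 32 and u <= v + 16. *)
have uv2 : u + v <= 80 by lra.
apply: le_trans (ler_pM _ _ uv uv2) _ => //; first by rewrite addr_ge0.
by rewrite mulrAC; lra.
Qed.

Lemma measurable_sqr_cmod_derive1 :
  measurable_fun (disc R r : set (measurableTypeR R * measurableTypeR R))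
    (fun q => cmod (derive1 f (pt q)) ^+ 2).
Proof.
apply: (@measurable_fun_cvg _ _ _ _ (fun n q => cmod (P n)^`().[pt q] ^+ 2)).
  by move=> n; exact: (measurable_sqr_cmod _ _ _ (measurable_horner_pt _ _ _)).
move=> q /disc_half q2; apply/cvgrPdist_le => e e0.
have q0 : 0 <= 3 / 4 :> R by lra.
have q1 : 3 / 4 < 1 :> R by lra.
have K0 : 0 < 1280 :> R by rewrite ltr0n.
have e1 := divr_gt0 e0 K0.
have [N HN] := expr_lt_eventually R (3 / 4) (e / 1280) q0 q1 e1.
exists N => // n /= /HN Hn; apply: le_trans (sqr_cmod_derive1_taylor n _ q2) _.
by rewrite mulrC -(ler_pdivlMr _ _ K0) ltW.
Qed.

(** The uniform error in |f'|^2 is multiplied by the area pi r^2 <= pi. The polynomial is [P n.+1],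
    whose derivative has exactly the n coefficients (k+1) a_(k+1). *)
Lemma disc_area_approx n :
  `|disc_area f r -
    pi * \sum_(k < n) k.+1%:R * cmod (a k.+1) ^+ 2 * r ^+ (k.+1).*2| <=
  1280 * pi * (3 / 4) ^+ n.+1.
Proof.
set I0 := \sum_(k < n) _.
set e := (3 / 4) ^+ n.+1; have e0 : 0 <= e by rewrite exprn_ge0 //; lra.
have [B [BE B0]] : exists B : R, B = 1280 * e /\ 0 <= B.
  by exists (1280 * e); split=> [//|]; rewrite mulr_ge0 ?ler0n.
set Ae := B * (pi * r ^+ 2).
have r21 : r ^+ 2 <= 1 by rewrite expr_le1 //; move: r1; lra.
have Ae_le : Ae <= 1280 * pi * e.
  have pe0 : 0 <= pi * e by rewrite mulr_ge0 // pi_ge0.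
  have -> : Ae = 1280 * (pi * e * r ^+ 2) by rewrite /Ae BE; ring.
  by rewrite -(mulrA 1280 pi e) ler_wpM2l ?ler0n // ler_piMr.
have mD := measurable_disc R r.
have EP : (\int[plane_measure R]_(q in disc R r)
    (cmod (P n.+1)^`().[pt q] ^+ 2)%:E = (pi * I0)%:E)%E.
  rewrite (parseval_disc_poly _ _ _ n r0); last first.
    by apply/leq_sizeP => j nj;
      rewrite coef_deriv coef_poly ltnS ltnNge nj mul0rn.
  congr EFin; congr (_ * _); apply: eq_bigr => k _.
  have -> : (P n.+1)^`()`_k = k.+1%:R * a k.+1 :> R[i].
    by rewrite coef_deriv coef_poly ltnS ltn_ord mulr_natl.
  rewrite cmodM.
  have -> : cmod (k.+1%:R : R[i]) = k.+1%:R.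
    by rewrite -(rmorph_nat (real_complex R)) cmod_real normr_nat.
  by rewrite exprMn; field; rewrite addrC natr1 pnatr_eq0.
have mf : measurable_fun (disc R r : set (measurableTypeR R * measurableTypeR
  R))
    (fun q => (cmod (derive1 f (pt q)) ^+ 2)%:E).
  by apply/measurable_EFinP; exact: measurable_sqr_cmod_derive1.
have mP : measurable_fun (disc R r : set (measurableTypeR R * measurableTypeR
  R))
    (fun q => (cmod (P n.+1)^`().[pt q] ^+ 2)%:E).
  apply/measurable_EFinP.
  exact: (measurable_sqr_cmod _ _ _ (measurable_horner_pt _ _ _)).
have Ie : (\int[plane_measure R]_(q in disc R r) (cst B%:E q) =
    Ae%:E)%E.
  by rewrite integral_cst // EFinM [X in (_ * X)%E](plane_measure_disc _ _ r0).
have H q : disc R r q -> `|cmod (derive1 f (pt q)) ^+ 2 -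
    cmod (P n.+1)^`().[pt q] ^+ 2| <= B.
  by move=> /disc_half; rewrite BE; exact: sqr_cmod_derive1_taylor.
(* Both comparisons are written with sums of nonnegative integrals, because finiteness of the
   integral of |f'|^2 is itself deduced from this one. *)
have up : (\int[plane_measure R]_(q in disc R r)
    (cmod (derive1 f (pt q)) ^+ 2)%:E <= (pi * I0 + Ae)%:E)%E.
  rewrite EFinD -EP -Ie -ge0_integralD //; first 1 last.
  - by move=> q _; rewrite lee_fin sqr_ge0.
  apply: ge0_le_integral => //.
  - by move=> q _; rewrite lee_fin sqr_ge0.
  - exact: emeasurable_funD.
  - by move=> q /H; rewrite lee_fin ler_norml; lra.
have lo : ((pi * I0)%:E <= \int[plane_measure R]_(q in disc R r)
    (cmod (derive1 f (pt q)) ^+ 2)%:E + Ae%:E)%E.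
  rewrite -EP -Ie -ge0_integralD //; first 1 last.
  - by move=> q _; rewrite lee_fin sqr_ge0.
  apply: ge0_le_integral => //.
  - by move=> q _; rewrite lee_fin sqr_ge0.
  - exact: emeasurable_funD.
  - by move=> q /H; rewrite lee_fin ler_norml; lra.
have fin : (\int[plane_measure R]_(q in disc R r)
    (cmod (derive1 f (pt q)) ^+ 2)%:E)%E \is a fin_num.
  rewrite ge0_fin_numE; first exact: (le_lt_trans up (ltry _)).
  by apply: integral_ge0 => q _; rewrite lee_fin sqr_ge0.
rewrite /disc_area /Rintegral -/(disc R r).
rewrite -(fineK fin) in up lo; rewrite -EFinD lee_fin in lo;
  rewrite lee_fin in up.
by rewrite ler_norml; apply/andP; split; move: up lo; lra.
Qed.

End area.

(** * The constant *)

Lemma le_of_geometric_error (R : realType) (x y C : R) : 0 <= C ->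
  (forall n, x <= y + C * (3 / 4) ^+ n.+1) -> x <= y.
Proof.
move=> C0 H; apply/ler_addgt0Pr => e e0.
have q0 : 0 <= 3 / 4 :> R by lra.
have q1 : 3 / 4 < 1 :> R by lra.
have C1 : 0 < C + 1 by lra.
have [N HN] := expr_lt_eventually R (3 / 4) (e / (C + 1)) q0 q1 (divr_gt0 e0
  C1).
apply: le_trans (H N) _; rewrite lerD2l.
have := HN N.+1 (leqnSn N); rewrite ltr_pdivlMr // => h.
have h0 : 0 <= (3 / 4) ^+ N.+1 :> R by rewrite exprn_ge0.
by move: h h0; set t := _ ^+ _; lra.
Qed.

Section sharp_formula_bounds.
Variable R : realType.
Implicit Types r rho A lam : R.

(** The normalised area S_r / pi of the Moebius map with parameter [A], in closed form. *)
Definition moebius_area r A := (r * (1 - A ^+ 2) / (1 - A ^+ 2 * r ^+ 2)) ^+ 2.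

(** The computation rests on (1 - A^2 r^2)^2 - r^2 (1 - A^2)^2 = (1 - r^2) (1 - A^4 r^2), the origin
    of two factors of the sharp formula. *)
Lemma moebius_area_ratio r A : 0 <= A -> A < 1 -> 0 <= r -> r <= 1 / 3 ->
  moebius_area r A < 1 /\
  moebius_area r A / (1 - moebius_area r A) =
  (1 - A ^+ 2) ^+ 2 * r ^+ 2 / ((1 - r ^+ 2) * (1 - A ^+ 4 * r ^+ 2)).
Proof.
move=> A0 A1 r0 r1.
have r2 : r ^+ 2 <= 1 / 9 by rewrite expr2; nra.
have r20 := sqr_ge0 r; have A20 := sqr_ge0 A.
have A2 : A ^+ 2 < 1 by rewrite expr_lt1.
have E4 : A ^+ 4 = A ^+ 2 * A ^+ 2 by rewrite -exprD.
have d1 : 0 < 1 - A ^+ 2 * r ^+ 2 by nra.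
have d2 : 0 < 1 - r ^+ 2 by lra.
have d3 : 0 < 1 - A ^+ 4 * r ^+ 2 by rewrite E4; nra.
have E : 1 - moebius_area r A =
    (1 - r ^+ 2) * (1 - A ^+ 4 * r ^+ 2) / (1 - A ^+ 2 * r ^+ 2) ^+ 2.
  by rewrite /moebius_area E4; field; rewrite exprMn gt_eqF.
have E1 : 0 < 1 - moebius_area r A.
  by rewrite E divr_gt0 ?mulr_gt0 // exprn_gt0.
split; first by rewrite -subr_gt0.
rewrite E /moebius_area expr_div_n exprMn [r ^+ 2 * _]mulrC.
have gen (x d p : R) : 0 < d -> x / d ^+ 2 / (p / d ^+ 2) = x / p.
  by move=> d0; rewrite invf_div mulrA divfK // expf_neq0 // gt_eqF.
exact: gen.
Qed.

(** The constant belongs to the radius [rho] but is applied at every smaller r. Each factor of the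
    formula is nonnegative and antitone in the radius; rho <= 1/3 makes 1 - rho (1 + 2 A)
    nonnegative. *)
Lemma sharp_formula_antitone r rho A : 0 < r -> r <= rho -> rho <= 1 / 3 ->
  0 <= A -> A < 1 -> sharp_formula rho A <= sharp_formula r A.
Proof.
move=> r0 rrho rho3 A0 A1; have rho0 := lt_le_trans r0 rrho.
have s0 : 0 < r ^+ 2 by rewrite exprn_gt0.
have s1 : 0 < rho ^+ 2 by rewrite exprn_gt0.
have s2 : r ^+ 2 <= rho ^+ 2 by rewrite lerXn2r // nnegrE ltW.
have s3 : rho ^+ 2 <= 1 / 9 by rewrite expr2; nra.
have A4 : A ^+ 4 <= 1 by rewrite expr_le1 // ltW.
have A40 : 0 <= A ^+ 4 by rewrite exprn_ge0.
have Ap : 0 < (1 - A) * (1 + A) ^+ 2 by rewrite mulr_gt0 ?exprn_gt0 //; lra.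
rewrite /sharp_formula; apply: ler_pM.
- rewrite mulr_ge0 ?divr_ge0 //; [lra|exact: ltW|nra|exact: ltW].
- by rewrite divr_ge0 //; nra.
- apply: ler_pM.
  + by rewrite divr_ge0 //; lra.
  + by rewrite divr_ge0 // ?(ltW Ap) //; nra.
  + by rewrite ler_pdivrMr // mulrAC ler_pdivlMr //; nra.
  + by rewrite ler_wpM2r ?invr_ge0 ?(ltW Ap) //; nra.
- have d1 : 0 < 1 - A * rho by nra.
  have d2 : 0 < 1 - A * r by nra.
  by rewrite ler_pdivrMr // mulrAC ler_pdivlMr //; nra.
Qed.

(** This identity is where the formula comes from: it is the slack that the Moebius map leaves in
    Bohr's inequality, (1 - A) (1 - r (1 + 2 A)) / (1 - A r), divided by the area ratio of that
    map. *)
Lemma sharp_formula_area r A : 0 <= A -> A < 1 -> 0 < r -> r <= 1 / 3 ->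
  sharp_formula r A * (moebius_area r A / (1 - moebius_area r A)) =
  1 - A - r * (1 - A ^+ 2) / (1 - A * r).
Proof.
move=> A0 A1 r0 r1; have [_ ->] := moebius_area_ratio r A A0 A1 (ltW r0) r1.
have r2 : r ^+ 2 <= 1 / 9 by rewrite expr2; nra.
have A2 : A ^+ 2 < 1 by rewrite expr_lt1.
have A20 := sqr_ge0 A.
have d1 : 1 - A * r != 0 by rewrite gt_eqF //; nra.
have d2 : 1 - r ^+ 2 != 0 by rewrite gt_eqF //; lra.
have d3 : 1 - A ^+ 4 * r ^+ 2 != 0.
  have A4 : A ^+ 4 <= 1 by rewrite expr_le1 // ltW.
  by rewrite gt_eqF //; have := ler_wpM2r (sqr_ge0 r) A4; lra.
have d4 : 1 - A != 0 by rewrite gt_eqF //; lra.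
have d5 : 1 + A != 0 by rewrite gt_eqF //; lra.
have d6 : r != 0 by rewrite gt_eqF.
by rewrite /sharp_formula; field; rewrite d1 d2 d3 d4 d5 d6.
Qed.

(* For A < r the constant is tested against the Moebius map with parameter r,
   for which sharp_formula r r = (1 + r^2 + r^4) (1 - 2 r) / r^2. *)
Lemma small_coef_ineq r A lam : 0 <= A -> A < r -> r <= 1 / 3 -> 0 <= lam ->
  lam <= sharp_formula r r ->
  A + r / 2 * (1 + (1 - A ^+ 2) / (1 - r ^+ 2)) +
    lam * (moebius_area r A / (1 - moebius_area r A)) <= 1.
Proof.
move=> A0 Ar r1 lam0 lamF; have r0 := le_lt_trans A0 Ar.
have A1 : A < 1 by lra.
have [_ ->] := moebius_area_ratio r A A0 A1 (ltW r0) r1.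
have r2 : r ^+ 2 <= 1 / 9 by rewrite expr2; nra.
have r20 : 0 < r ^+ 2 by rewrite exprn_gt0.
have A20 := sqr_ge0 A.
have A4r : A ^+ 4 <= r ^+ 4 by rewrite lerXn2r ?nnegrE // ltW.
have d2 : 0 < 1 - r ^+ 2 by lra.
have E6 : r ^+ 6 = r ^+ 4 * r ^+ 2 by rewrite -exprD.
have r4 : r ^+ 4 <= 1 by rewrite expr_le1 //; lra.
have r40 : 0 <= r ^+ 4 by rewrite exprn_ge0 // ltW.
have Ar2 := ler_wpM2r (ltW r20) A4r.
have Ar3 := ler_wpM2r (ltW r20) r4.
have d3 : 0 < 1 - A ^+ 4 * r ^+ 2 by lra.
set X := (1 - A ^+ 2) / (1 - r ^+ 2).
have EF : sharp_formula r r = (1 - r ^+ 6) * (1 - 2 * r) / (r ^+ 2 * (1 - r ^+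
  2)).
  rewrite /sharp_formula E6; field.
  rewrite (gt_eqF r0) /=; do ?[apply/andP; split]; rewrite gt_eqF //; nra.
(* Inserting the value at parameter r leaves an extra factor (1 - r^6) / (1 - A^4 r^2), at most 1
   because A < r. *)
have lamX : lam * ((1 - A ^+ 2) ^+ 2 * r ^+ 2 /
    ((1 - r ^+ 2) * (1 - A ^+ 4 * r ^+ 2))) <= (1 - 2 * r) * X ^+ 2.
  have g0 : 0 <= (1 - A ^+ 2) ^+ 2 * r ^+ 2 /
      ((1 - r ^+ 2) * (1 - A ^+ 4 * r ^+ 2)).
    by apply: divr_ge0; apply: mulr_ge0; rewrite ?sqr_ge0 // ltW.
  apply: le_trans (ler_wpM2r g0 lamF) _; rewrite EF.
  have -> : (1 - r ^+ 6) * (1 - 2 * r) / (r ^+ 2 * (1 - r ^+ 2)) *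
    ((1 - A ^+ 2) ^+ 2 * r ^+ 2 / ((1 - r ^+ 2) * (1 - A ^+ 4 * r ^+ 2))) =
    (1 - 2 * r) * X ^+ 2 * ((1 - r ^+ 6) / (1 - A ^+ 4 * r ^+ 2)).
    rewrite /X expr_div_n;
      move: (1 - r ^+ 6) (1 - 2 * r) (1 - A ^+ 4 * r ^+ 2) d3.
    move: (1 - A ^+ 2) (1 - r ^+ 2) d2 => y d d0 b c w w0.
    by field; rewrite (gt_eqF r0) (gt_eqF w0) (gt_eqF d0).
  rewrite ler_piMr //; first by rewrite mulr_ge0 ?sqr_ge0 //; lra.
  by rewrite ler_pdivrMr // mul1r E6; lra.
(* At A = r one has X = 1 and the bounds add up to exactly 1. With e = X - 1 the claim becomes e
   (r/2 + (1 - 2 r) (2 + e)) <= r - A, and e = (r - A) v supplies the factor r - A. *)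
have XE : X = 1 + (r - A) * ((r + A) / (1 - r ^+ 2)).
  by rewrite /X; field; rewrite gt_eqF.
set v := (r + A) / (1 - r ^+ 2) in XE.
have v0 : 0 <= v by rewrite divr_ge0 ?(ltW d2) // addr_ge0 // ltW.
have v1 : v <= 9 / 4 * r by rewrite ler_pdivrMr //; nra.
have m0 : 0 < r - A by lra.
have dl : (r - A) * v <= 1 / 8.
  have : X <= 9 / 8 by rewrite ler_pdivrMr //; lra.
  by rewrite XE; lra.
have dv : (r - A) * v <= 9 / 4 * r * (r - A) by rewrite mulrC ler_wpM2r // ltW.
have dv0 : 0 <= (r - A) * v by rewrite mulr_ge0 // ltW.
move: lamX dl dv dv0; rewrite XE; set e := (r - A) * v => lamX dl dv e0.
(* 17/8 is 2 plus the bound 1/8 on e, which comes from X <= 1 / (1 - r^2) <= 9/8. *)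
set K := r / 2 + (1 - 2 * r) * (17 / 8).
have K0 : 0 <= K by rewrite /K; lra.
have K1 : 9 / 4 * r * K <= 1 by rewrite /K; nra.
have h1 : e * (r / 2 + (1 - 2 * r) * (2 + e)) <= e * K.
  by rewrite ler_wpM2l // /K lerD2l ler_wpM2l //; lra.
have h2 := ler_wpM2r K0 dv.
have h3 := ler_wpM2r (ltW m0) K1.
by lra.
Qed.

End sharp_formula_bounds.

(** * The inequality with the constant *)

Lemma bohr_ineq_of_tail (R : realType) (f : R[i]^o -> R[i]^o)
    (a : nat -> R[i]^o) (r lam T : R) : 0 <= r ->
  (forall n, \sum_(k < n) cmod (a k.+1) * r ^+ k.+1 <= T) ->
  cmod (a 0%N) + T + lam * (disc_area f r / (pi - disc_area f r)) <= 1 ->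
  bohr_ineq f a r lam.
Proof.
move=> r0 HT H; rewrite /bohr_ineq.
have F0 k : 0 <= cmod (a k) * r ^+ k by rewrite mulr_ge0 ?cmod_ge0 ?exprn_ge0.
apply: (@le_trans _ _ ((cmod (a 0%N) + T)%:E +
    (lam * (disc_area f r / (pi - disc_area f r)))%:E)%E); last first.
  by rewrite -EFinD lee_fin.
apply: leeD => //; apply: lime_le.
  by apply: is_cvg_nneseries => n _ _; rewrite lee_fin.
apply: nearW => n; rewrite sumEFin lee_fin big_mkord.
case: n => [|n]; first by rewrite big_ord0 addr_ge0 ?cmod_ge0 // (le_trans _
  (HT 0%N)) // big_ord0.
rewrite big_ord_recl expr0 mulr1 lerD2l.
exact: HT.
Qed.

Lemma ratio_pi_le (R : realType) (S m : R) : 0 <= S -> S <= pi * m -> m < 1 ->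
  S / (pi - S) <= m / (1 - m).
Proof.
move=> S0 Sm m1; have pi0 := pi_gt0 R.
have h : pi * m < pi * 1 by rewrite ltr_pM2l.
have d1 : 0 < pi - S by lra.
have d2 : 0 < 1 - m by lra.
by rewrite ler_pdivrMr // mulrAC ler_pdivlMr //; lra.
Qed.

Lemma disc_area_ge0 (R : realType) (f : R[i]^o -> R[i]^o) (r : R) :
  0 <= disc_area f r.
Proof. by apply: Rintegral_ge0 => q _; exact: sqr_ge0. Qed.

Lemma disc_area_le_moebius (R : realType) (f : R[i]^o -> R[i]^o)
    (a : nat -> R[i]^o) (r : R) : classB f a -> 0 <= r -> r <= 1 / 3 ->
  disc_area f r <= pi * moebius_area R r (cmod (a 0%N)).
Proof.
move=> fB r0 r1.
have C0 : 0 <= 1280 * pi :> R by rewrite mulr_ge0 ?ler0n ?pi_ge0.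
apply: (le_of_geometric_error _ _ _ _ C0) => n.
have := disc_area_approx R f a fB r r0 r1 n.
have := ler_wpM2l (pi_ge0 R) (sum_area_le R f a fB r n r0 r1).
rewrite -/(moebius_area R r (cmod (a 0%N))).
move: (1280 * pi * _) (pi * _) (pi * _) => e u v uv.
by rewrite ler_norml => /andP[_]; lra.
Qed.

Lemma bohr_ineq_le_sharp_formula (R : realType) (f : R[i]^o -> R[i]^o)
    (a : nat -> R[i]^o) (rho r lam : R) :
  rho <= 1 / 3 -> 0 <= lam ->
  (forall A, 0 <= A -> A < 1 -> lam <= sharp_formula rho A) ->
  classB f a -> 0 <= r -> r <= rho -> bohr_ineq f a r lam.
Proof.
move=> rho3 lam0 lamF fB r0 rrho; have r3 := le_trans rrho rho3.
set A := cmod (a 0%N).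
have A0 : 0 <= A := cmod_ge0 R (a 0%N).
have A1 : A <= 1 := cmod_coef_le1 R f a fB 0%N.
have S0 := disc_area_ge0 R f r.
have Sm := disc_area_le_moebius R f a r fB r0 r3; rewrite -/A in Sm.
have area0 : moebius_area R r A = 0 -> disc_area f r = 0.
  by move=> m0; apply/eqP; rewrite eq_le S0 andbT; rewrite m0 mulr0 in Sm.
move: r0; rewrite le_eqVlt => /predU1P[r0|r0].
  apply: (bohr_ineq_of_tail _ _ _ _ _ 0); first by rewrite -r0.
    by move=> n; rewrite big1 // => k _; rewrite -r0 exprS mul0r mulr0.
  by rewrite area0 ?mul0r ?mulr0 ?addr0 // /moebius_area -r0 !mul0r expr0n.
(* If |a_0| = 1, all later coefficients and the area vanish; the sharp formula is only available for
   A < 1. *)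
move: A1; rewrite le_eqVlt => /predU1P[A1|A1].
  apply: (bohr_ineq_of_tail _ _ _ _ _ 0); first exact: ltW.
    move=> n; rewrite big1 // => k _.
    have := sqr_coef_le R f a fB k.+1 isT.
    rewrite -/A A1 expr1n subrr mul0r => h.
    suff -> : cmod (a k.+1) = 0 by rewrite mul0r.
    by apply/eqP; rewrite -sqrf_eq0 eq_le h sqr_ge0.
  rewrite area0; first by rewrite mul0r mulr0 !addr0 -/A A1.
  by rewrite /moebius_area A1 expr1n subrr mulr0 mul0r expr0n.
have [m1 _] := moebius_area_ratio R r A A0 A1 (ltW r0) r3.
have lamX : lam * (disc_area f r / (pi - disc_area f r)) <=
    lam * (moebius_area R r A / (1 - moebius_area R r A)).
  by rewrite ler_wpM2l // ratio_pi_le.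
have m0 : 0 <= moebius_area R r A / (1 - moebius_area R r A).
  by rewrite divr_ge0 ?sqr_ge0 // subr_ge0 ltW.
have [rA|Ar] := leP r A.
  apply: (bohr_ineq_of_tail _ _ _ _ _ (r * (1 - A ^+ 2) / (1 - A * r))).
  - exact: ltW.
  - move=> n; apply: (sum_coef_le_moebius R f a fB) => //; first exact: ltW.
    exact: lt_le_trans rA.
  have F : lam <= sharp_formula r A.
    apply: le_trans (lamF A A0 A1) _.
    exact: sharp_formula_antitone.
  have := ler_wpM2r m0 F; rewrite sharp_formula_area // -/A.
  by move: lamX; lra.
have r1 : r < 1 by lra.
apply: (bohr_ineq_of_tail _ _ _ _ _ (r / 2 * (1 + (1 - A ^+ 2) / (1 - r ^+
  2)))).
- exact: ltW.
- by move=> n; exact: (sum_coef_le_cauchy R f a fB).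
have F : lam <= sharp_formula r r.
  apply: le_trans (lamF r (ltW r0) r1) _.
  by apply: sharp_formula_antitone => //; exact: ltW.
apply: le_trans (small_coef_ineq R r A lam A0 Ar r3 lam0 F).
by rewrite -/A lerD2l.
Qed.

(** * Extremality of the Moebius maps *)

Section moebius.
Variables (R : realType) (A : R).
Hypotheses (A0 : 0 <= A) (A1 : A < 1).

Definition moebius (z : R[i]^o) : R[i]^o := (A%:C%C - z) / (1 - A%:C%C * z).

Definition moebius_coef (k : nat) : R[i]^o :=
  if k is k'.+1 then (- ((1 - A ^+ 2) * A ^+ k'))%:C%C else A%:C%C.

Lemma moebius_den_neq0 (z : R[i]) : cmod z < 1 -> 1 - A%:C%C * z != 0.
Proof.
move=> z1; apply/eqP => /eqP; rewrite subr_eq0 => /eqP E.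
have := cmodM R A%:C%C z; rewrite -E cmod1 cmod_real ger0_norm //.
by have := ler_wpM2r (cmod_ge0 R z) (ltW A1); rewrite mul1r => h E1; move: z1;
  rewrite ltNge; case/negP; rewrite E1.
Qed.

Lemma moebius_le1 (z : R[i]) : cmod z < 1 -> cmod (moebius z) <= 1.
Proof.
move=> z1; have d0 := moebius_den_neq0 z z1.
have n0 : 0 < cmod (1 - A%:C%C * z).
  rewrite lt_neqAle cmod_ge0 andbT eq_sym; apply: contra d0 => /eqP h.
  by rewrite -normr_eq0 cmodE h.
rewrite /moebius cmodM cmodV ler_pdivrMr // mul1r.
rewrite -(@ler_pXn2r _ 2) ?nnegrE ?cmod_ge0 //.
have z2 : cmod z ^+ 2 < 1 by rewrite expr_lt1 ?cmod_ge0.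
move: z2; case: z {z1 d0 n0} => x y; rewrite !sqr_cmod /= => z2.
rewrite -subr_ge0 (_ : _ - _ = (1 - A ^+ 2) * (1 - (x ^+ 2 + y ^+ 2))).
  by rewrite mulr_ge0 // subr_ge0 ?expr_le1 // ltW.
by ring.
Qed.

Lemma moebius_partial_sum (z : R[i]) n : cmod z < 1 ->
  \sum_(k < n.+1) moebius_coef k * z ^+ k =
  moebius z + (1 - A ^+ 2)%:C%C * z * (A%:C%C * z) ^+ n / (1 - A%:C%C * z).
Proof.
move=> z1; have d0 := moebius_den_neq0 z z1.
elim: n => [|n IH].
  rewrite big_ord_recl big_ord0 addr0 /= expr0 mulr1 /moebius.
  rewrite rmorphB rmorphXn rmorph1 /=.
  by field.
rewrite big_ord_recr /= IH rmorphN rmorphM rmorphB rmorphXn rmorph1 /=.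
rewrite rmorphXn /= exprMn ![_ ^+ n.+1]exprS exprMn.
by field.
Qed.

Lemma moebius_classB : classB moebius moebius_coef.
Proof.
split.
- move=> z z1; apply: derivableM.
    by apply: derivableB; [exact: derivable_cst|exact: derivable_id].
  apply: derivableV; first exact: moebius_den_neq0.
  apply: derivableB; first exact: derivable_cst.
  by apply: derivableM; [exact: derivable_cst|exact: derivable_id].
- move=> z z1; apply/cvg_cmodP => e e0.
  have d0 := moebius_den_neq0 z z1.
  set K := cmod ((1 - A ^+ 2)%:C%C * z / (1 - A%:C%C * z)).
  have K0 : 0 < K + 1 by rewrite ltr_wpDl ?cmod_ge0.
  have q0 : 0 <= cmod (A%:C%C * z) by exact: cmod_ge0.
  have q1 : cmod (A%:C%C * z) < 1.
    by rewrite cmodM cmod_real ger0_norm // mulr_ilt1 ?cmod_ge0.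
  have [N HN] := expr_lt_eventually R _ (e / (K + 1)) q0 q1 (divr_gt0 e0 K0).
  exists N.+1 => -[//|n]; rewrite ltnS => /HN Hn.
  rewrite /series /= big_mkord moebius_partial_sum // addrAC subrr add0r.
  rewrite mulrAC cmodM cmodX -/K; rewrite ltr_pdivlMr // in Hn.
  have : 0 <= cmod (A%:C%C * z) ^+ n by rewrite exprn_ge0.
  by move: Hn; set t := _ ^+ n; lra.
- exact: moebius_le1.
Qed.

Lemma cmod_moebius_coefS k :
  cmod (moebius_coef k.+1) = (1 - A ^+ 2) * A ^+ k.
Proof.
rewrite /moebius_coef cmod_real normrN ger0_norm // mulr_ge0 ?exprn_ge0 //.
by rewrite subr_ge0 expr_le1 // ltW.
Qed.

Lemma cmod_moebius_coef0 : cmod (moebius_coef 0) = A.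
Proof. by rewrite /moebius_coef cmod_real ger0_norm. Qed.

(** The general upper bound applies to the map itself. The lower bound comes from the approximating
    sums, whose shortfall from the closed form is explicit. *)
Lemma disc_area_moebius (r : R) : 0 <= r -> r <= 1 / 3 ->
  disc_area moebius r = pi * moebius_area R r A.
Proof.
move=> r0 r1; apply/eqP; rewrite eq_le; apply/andP; split.
  by have := disc_area_le_moebius R _ _ r moebius_classB r0 r1;
    rewrite cmod_moebius_coef0.
have A2 : A ^+ 2 < 1 by rewrite expr_lt1.
have r2 : r ^+ 2 <= 1 / 9 by rewrite expr2; nra.
have r20 := sqr_ge0 r; have A20 := sqr_ge0 A.
pose q := A ^+ 2 * r ^+ 2.
have q0 : 0 <= q by rewrite mulr_ge0.
have q2 : q <= 1 / 2 by rewrite /q; nra.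
have d0 : 0 < 1 - q by lra.
have pim : 0 <= pi * moebius_area R r A by rewrite mulr_ge0 ?pi_ge0 ?sqr_ge0.
(* The first term pays for the polynomial approximation of the area, the second for truncating the
   series: as q <= 1/2, the shortfall is at most (n + 1) (1/2)^n <= 4 (3/4)^(n+1). *)
pose C := 1280 * pi + pi * moebius_area R r A * 4.
have C0 : 0 <= C.
  by apply: addr_ge0; [rewrite mulr_ge0 ?ler0n ?pi_ge0|exact: mulr_ge0].
apply: (le_of_geometric_error _ _ _ _ C0) => n.
have := disc_area_approx R _ _ moebius_classB r r0 r1 n.
have -> : \sum_(k < n) k.+1%:R * cmod (moebius_coef k.+1) ^+ 2 * r ^+ k.+1.*2 =
    moebius_area R r A * (1 - q ^+ n - n%:R * q ^+ n * (1 - q)).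
  rewrite -sum_arith_geom /moebius_area -/q expr_div_n.
  rewrite mulrCA divfK ?expf_neq0 ?gt_eqF // mulrC mulr_sumr.
  apply: eq_bigr => k _.
  rewrite cmod_moebius_coefS -mul2n exprM [(r ^+ 2) ^+ k.+1]exprS.
  rewrite !exprMn [(A ^+ k) ^+ 2]exprAC /q exprMn; ring.
set e := (3 / 4) ^+ n.+1.
have Hn : q ^+ n + n%:R * q ^+ n * (1 - q) <= 4 * e.
  have n0 : 0 <= n%:R :> R by rewrite ler0n.
  have h1 : q ^+ n <= (1 / 2) ^+ n by rewrite lerXn2r // nnegrE; lra.
  have h2 := half_pow_le R n.+1; rewrite /= -/e -[n.+1%:R]natr1 in h2.
  have h3 : 0 <= q ^+ n by rewrite exprn_ge0.
  have h4 : n%:R * q ^+ n <= n%:R * (1 / 2) ^+ n by rewrite ler_wpM2l.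
  have h5 : 0 <= n%:R * q ^+ n * q by rewrite !mulr_ge0.
  by lra.
have := ler_wpM2l pim Hn.
rewrite ler_norml /C => h /andP[+ _].
clearbody e; move: h; clear.
move: (moebius_area R r A) (q ^+ n) n%:R (disc_area moebius r) => m v w d.
by lra.
Qed.

Lemma bohr_moebius_sharp (rho lam : R) : 0 < rho -> rho <= 1 / 3 ->
  bohr_ineq moebius moebius_coef rho lam -> lam <= sharp_formula rho A.
Proof.
move=> r0 r1; rewrite /bohr_ineq disc_area_moebius ?(ltW r0) //.
have A2 : A ^+ 2 < 1 by rewrite expr_lt1.
set m := moebius_area R rho A.
have [m1 mE] := moebius_area_ratio R rho A A0 A1 (ltW r0) r1.
have pi0 := pi_gt0 R.
have d1 : 0 < 1 - m by rewrite subr_gt0.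
have m0 : 0 < m.
  rewrite /m /moebius_area exprn_gt0 // divr_gt0 ?mulr_gt0 ?subr_gt0 //.
  by have : rho ^+ 2 <= 1 / 9; [rewrite expr2; nra|]; have := sqr_ge0 A; nra.
have -> : pi * m / (pi - pi * m) = m / (1 - m).
  rewrite (_ : pi - pi * m = pi * (1 - m)); last by ring.
  by rewrite -mulf_div divff ?mul1r // gt_eqF.
set X := m / (1 - m); have X0 : 0 < X by rewrite divr_gt0.
have Ar0 : 0 <= A * rho by rewrite mulr_ge0 // ltW.
have Ar1 : A * rho < 1 by nra.
have F := sharp_formula_area R rho A A0 A1 r0 r1; rewrite -/m -/X in F.
move=> H; rewrite -(ler_pM2r X0) F.
have D0 : 0 < 1 - A * rho by lra.
set B := rho * (1 - A ^+ 2) / (1 - A * rho).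
have B0 : 0 <= B by rewrite divr_ge0 ?mulr_ge0 ?(ltW r0) ?(ltW D0) // subr_ge0
  ltW.
suff : A + B + lam * X <= 1 by lra.
(* These are the partial sums of Bohr's series for the map; the missing part B (A rho)^n is a
   geometric error, since A rho <= 3/4. *)
have Hn n : A + B * (1 - (A * rho) ^+ n) + lam * X <= 1.
  rewrite -lee_fin EFinD; apply: le_trans H; apply: leeD => //.
  have -> : A + B * (1 - (A * rho) ^+ n) =
      \sum_(0 <= k < n.+1) cmod (moebius_coef k) * rho ^+ k.
    rewrite big_mkord big_ord_recl cmod_moebius_coef0 expr0 mulr1;
      congr (_ + _).
    under eq_bigr do rewrite lift0 cmod_moebius_coefS.
    elim: n => [|n IH]; first by rewrite big_ord0 expr0 subrr mulr0.
    rewrite big_ord_recr -IH /=.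
    rewrite (exprS rho n) (exprS _ n) exprMn /B.
    by field; rewrite gt_eqF.
  rewrite -sumEFin; apply: nneseries_lim_ge => k _ _.
  by rewrite lee_fin mulr_ge0 ?cmod_ge0 ?exprn_ge0 // ltW.
apply: (le_of_geometric_error _ _ _ _ B0) => n.
have := Hn n.+1.
have h : (A * rho) ^+ n.+1 <= (3 / 4) ^+ n.+1.
  by rewrite lerXn2r ?nnegrE //; nra.
by have := ler_wpM2l B0 h; lra.
Qed.

End moebius.

Theorem theorem3p1 (R : realType) (rho : R) (rho_gt0 : 0 < rho)
    (rho_le : rho <= 1 / 3) :
  (forall (f : R[i]^o -> R[i]^o) (a : nat -> R[i]^o), classB f a ->
     forall r : R, 0 <= r <= rho -> bohr_ineq f a r (sharp_const rho))
  /\ sharp_const rho = inf [set sharp_formula rho a | a in `[0, 1[].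
Proof.
set F := [set sharp_formula rho a | a in _].
have F0 x : F x -> 0 <= x.
  move=> [A]; rewrite /= in_itv /= => /andP[A0 A1] <-.
  have [m1 _] := moebius_area_ratio R rho A A0 A1 (ltW rho_gt0) rho_le.
  have A2 : A ^+ 2 < 1 by rewrite expr_lt1.
  have r2 : rho ^+ 2 <= 1 / 9 by rewrite expr2; nra.
  have r20 : 0 < rho ^+ 2 by rewrite exprn_gt0.
  have A4 : A ^+ 4 <= 1 by rewrite expr_le1 // ltW.
  rewrite /sharp_formula; apply: mulr_ge0; first apply: mulr_ge0.
  - by rewrite divr_ge0 //; lra.
  - apply: divr_ge0; first by nra.
    by rewrite mulr_ge0 ?sqr_ge0 // subr_ge0 ltW.
  - by rewrite divr_ge0 //; nra.
(* Nonemptiness and a lower bound make [inf F] a genuine infimum. *)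
have F_inh : F !=set0 by exists (sharp_formula rho 0), 0;
  rewrite //= in_itv /= lexx ltr01.
have F_lb : has_lbound F by exists 0 => x /F0.
set L := inf F.
have L0 : 0 <= L by apply: lb_le_inf => // x /F0.
have LF A : 0 <= A -> A < 1 -> L <= sharp_formula rho A.
  move=> A0 A1; apply: ge_inf => //; exists A => //.
  by rewrite /= in_itv /= A0 A1.
have HL (f : R[i]^o -> R[i]^o) (a : nat -> R[i]^o) : classB f a ->
    forall r : R, 0 <= r <= rho -> bohr_ineq f a r L.
  move=> fB r /andP[r0 r1].
  exact: (bohr_ineq_le_sharp_formula R f a rho r L).
(* The supremum is attained: [L] is itself admissible by [HL], so the first claim follows from the
   equality. *)
suff E : sharp_const rho = L by split => //; rewrite E.
apply/eqP; rewrite eq_le; apply/andP; split.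
  (* Every admissible constant, tested on the Moebius map of parameter A at the radius rho, lies
     below the formula at A. *)
  apply: ge_sup; first by exists L.
  move=> lam [lam0 Hlam]; apply: lb_le_inf => // _ [A /= + <-].
  rewrite in_itv /= => /andP[A0 A1].
  apply: (bohr_moebius_sharp R A A0 A1) => //; apply: Hlam.
    exact: moebius_classB.
  by rewrite (ltW rho_gt0) lexx.
apply: ub_le_sup; last by split.
(* The Moebius map of parameter 0, which is z |-> -z, bounds the set of admissible constants. *)
exists (sharp_formula rho 0) => lam [lam0 Hlam].
apply: (bohr_moebius_sharp R 0 (lexx 0) ltr01) => //; apply: Hlam.
  exact: moebius_classB.
by rewrite (ltW rho_gt0) lexx.
Qed.
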